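(* Let $p\in(0,1)$ be a constant and let $G_p$ be the random graph on $n$ vertices in which each edge is present independently with probability $p$. Let $\sigma,\rho\subseteq\mathbb{N}$ be finite or co-finite. Then there is an algorithm that almost surely solves the minimum (respectively maximum) $(\sigma,\rho)$ vertex subset problem on input $G_p$ in time $$O^*\left(2^{O(d(\sigma,\rho)\cdot\log^4 n)}\right),$$ where the constant hidden in the exponent does not depend on $\sigma,\rho$ or $n$.
   Context: $\mathbb{N}=\{0,1,2,\dots\}$. A subset $X$ of vertices of a graph $G$ is a $(\sigma,\rho)$-set of $G$ if for every $v\in V(G)$: $|N(v)\cap X|\in\sigma$ if $v\in X$, and $|N(v)\cap X|\in\rho$ if $v\in V(G)\setminus X$, where $N(v)$ is the set of neighbors of $v$. The minimum (maximum) $(\sigma,\rho)$ vertex subset problem consists of finding the size of a minimum (maximum) $(\sigma,\rho)$-set in the input graph (or reporting that none exists). For a finite or co-finite $\mu\subseteq\mathbb{N}$, set $d(\mathbb{N})=0$ and otherwise $d(\mu)=1+\min\{\max\{x\in\mathbb{N}: x\in\mu\},\ \max\{x\in\mathbb{N}: x\notin\mu\}\}$, where the maximum of an infinite set is $+\infty$ and the maximum of the empty set is $-1$. Let $d(\sigma,\rho)=\max\{d(\sigma),d(\rho)\}$. The notation $O^*(\cdot)$ suppresses factors polynomial in $n$. ''Almost surely'' means with probability tending to $1$ as $n\to\infty$ over the choice of $G_p$. *)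

(* Defs.v *)
From HB Require Import structures.
From mathcomp Require Import all_boot all_order all_algebra.
From mathcomp Require Import finmap.
From mathcomp Require Import all_classical all_reals all_analysis.
Set Implicit Arguments.
Unset Strict Implicit.
Unset Printing Implicit Defensive.
Import Order.TTheory GRing.Theory Num.Theory.
Import numFieldNormedType.Exports.

Local Open Scope nat_scope.

Definition nbrs (T : finType) (e : rel T) (v : T) : {set T} :=
  [set u | e v u]%SET.

Definition sr_set (T : finType) (e : rel T) (sigma rho : set nat)
    (X : {set T}) : Prop :=
  forall v : T,
    (v \in X -> sigma #|nbrs e v :&: X|) /\
    (v \notin X -> rho #|nbrs e v :&: X|).

Inductive objective := Minimum | Maximum.

(* [None] stands for the report that there is no (sigma, rho)-set. *)
Definition sr_answer (opt : objective) (T : finType) (e : rel T)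
    (sigma rho : set nat) (a : option nat) : Prop :=
  match a with
  | None => forall X : {set T}, ~ sr_set e sigma rho X
  | Some k =>
      (exists2 X : {set T}, sr_set e sigma rho X & #|X| = k) /\
      (forall X : {set T}, sr_set e sigma rho X ->
         match opt with Minimum => k <= #|X| | Maximum => #|X| <= k end)
  end.

(* A random access machine with structured control flow: a program uses finitely
   many registers and an unbounded memory, both holding natural numbers of
   arbitrary size. Each instruction and each test of a conditional or of a loop
   takes one step. There is no multiplication, so the largest value at most
   doubles in a step (constants of the program aside), and t steps from an input
   of size N can be simulated by a Turing machine in time polynomial in t + N. *)
Inductive prog :=
| Const of nat & nat
| Add of nat & nat & nat
| Sub of nat & nat & nat
| Read of nat & nat
| Write of nat & nat
| Seq of prog & prog
| If of nat & prog & prog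
| While of nat & prog.

Record store := MkStore { reg : nat -> nat; mem : nat -> nat }.

Definition upd (f : nat -> nat) (a v : nat) : nat -> nat :=
  fun b => if b == a then v else f b.

Definition set_reg (s : store) (d v : nat) : store :=
  MkStore (upd (reg s) d v) (mem s).

(* A configuration is the stack of programs still to be run, and the store. *)
Definition config := (seq prog * store)%type.

Definition step (c : config) : config :=
  let: (K, s) := c in
  if K is P :: K' then
    match P with
    | Const d k => (K', set_reg s d k)
    | Add d a b => (K', set_reg s d (reg s a + reg s b))
    | Sub d a b => (K', set_reg s d (reg s a - reg s b))
    | Read d a => (K', set_reg s d (mem s (reg s a)))
    | Write a b => (K', MkStore (reg s) (upd (mem s) (reg s a) (reg s b)))
    | Seq P1 P2 => (P1 :: P2 :: K', s)
    | If a P1 P2 => ((if reg s a != 0 then P1 else P2) :: K', s)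
    | While a P1 => (if reg s a != 0 then P1 :: P :: K' else K', s)
    end
  else c.

(* Input: the number of vertices n in register 0, and the adjacency matrix in
   the memory cells 0, ..., n ^ 2 - 1, row by row. *)
Definition init_store (n : nat) (e : rel 'I_n) : store :=
  MkStore (fun a => if a == 0 then n else 0)
          (fun k => [exists i : 'I_n, exists j : 'I_n,
                       (k == i * n + j) && e i j] : nat).

(* Output: in register 0, as 0 for [None] and k.+1 for [Some k]. *)
Definition encode_answer (a : option nat) : nat :=
  if a is Some k then k.+1 else 0.

Definition returns (P : prog) (n : nat) (e : rel 'I_n) (t : nat)
    (a : option nat) : Prop :=
  let c := iter t step ([:: P], init_store e) in
  c.1 = [::] /\ reg c.2 0 = encode_answer a.

Local Open Scope ring_scope.

Definition solves_in_time (R : realType) (P : prog) (opt : objective)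
    (sigma rho : set nat) (n : nat) (T : R) (e : rel 'I_n) : Prop :=
  exists (t : nat) (a : option nat),
    [/\ t%:R <= T, returns P e t a & sr_answer opt e sigma rho a].

Definition fin_or_cofin (mu : set nat) : Prop :=
  finite_set mu \/ finite_set (~` mu)%classic.

Definition max_of (mu : set nat) : \bar int :=
  if `[< finite_set mu >]
  then (\big[Num.max/-1]_(x <- fset_set mu) x%:Z)%:E else +oo%E.

(* The minimum is finite when mu is finite or co-finite. *)
Definition d_of (mu : set nat) : int :=
  if `[< mu = setT >] then 0
  else 1 + fine (Order.min (max_of mu) (max_of (~` mu)%classic)).

Definition d_sr (sigma rho : set nat) : int := Num.max (d_of sigma) (d_of rho).

Definition vpairs (n : nat) : {set {set 'I_n}} :=
  [set f : {set 'I_n} | #|f| == 2%N]%SET.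

Definition adj (n : nat) (E : {set {set 'I_n}}) : rel 'I_n :=
  fun u v => [set u; v]%SET \in E.

Definition Gnp_weight (R : realType) (p : R) (n : nat)
    (E : {set {set 'I_n}}) : R :=
  \prod_(f in vpairs n) (if f \in E then p else 1 - p).

Definition Gnp_Pr (R : realType) (p : R) (n : nat)
    (Q : rel 'I_n -> Prop) : R :=
  \sum_(E in powerset (vpairs n) | `[< Q (adj E) >]) Gnp_weight p E.

Definition almost_surely (R : realType) (p : R)
    (Q : forall n : nat, rel 'I_n -> Prop) : Prop :=
  ((fun n : nat => Gnp_Pr p (@Q n)) @ \oo --> (1 : R))%classic.

(* Main.v *)
Require Import Defs.
From mathcomp Require Import all_boot all_order all_algebra.
From mathcomp Require Import all_classical all_reals all_analysis.
From mathcomp Require Import zify ring lra.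
Import Order.TTheory GRing.Theory Num.Theory.
Import numFieldNormedType.Exports.
Import Defs.
Set Implicit Arguments.
Unset Strict Implicit.
Unset Printing Implicit Defensive.
Local Open Scope nat_scope.

(** The programs run over all vertex sets that are small or have a small complement,
and the reason this is enough is that in a dense random graph a low degree
condition is incompatible with a large set.

Write L for the bit length of n. Almost surely any two disjoint sets of L^2
vertices are joined by an edge (call this mixing), since a given pair fails with
probability (1 - p)^(L^4) and there are at most n^(2 L^2) pairs. It follows that if
A and B are disjoint, |A| >= L^2 and |B| >= d L^2, then some vertex of A has at least
d neighbours in B ([mixing_degree]). Take d so large that membership in sigma and
rho is constant from d on.
 - If sigma is finite, a (sigma, rho)-set X cannot be split into such A and B, so
   |X| <= L^3.
 - If rho is finite, the complement of X and X cannot both be large, so one of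
   them has at most L^3 vertices.
 - If both are co-finite, every set in which each vertex has d neighbours is a
   solution. The whole vertex set is one, which settles the maximum. Almost surely
   so is an initial segment of d (L^2 + 1) vertices, because each vertex then has a
   neighbour in each of the d consecutive blocks of the segment; this bounds the
   minimum by L^3.
In each case an optimal solution, if there is any, is small or co-small
([extremal_solution]).

A set of at most L^3 vertices is coded by an integer below N = 2^(L^4): its base 2^L
digits list the vertices, and one more bit tells whether the set or its
complement is meant. The search program runs through all codes and never writes to
memory; to know whether a vertex is selected it recomputes the digits of the code by
repeated subtraction. This takes time polynomial in n and N, hence
poly(n) 2^(O(log^4 n)), and the exponent is the required one as soon as
d(sigma, rho) >= 1. The parameter d(sigma, rho) vanishes only when sigma and rho are
both empty or full, and then the answer is 0, n or none whatever the graph is.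

Running times are handled by a weakest precondition with a step bound ([wp]), and the
probabilities by one union bound over sets of missing edges ([Gnp_union_bound]). The
dependence of d on sigma and rho is harmless, because they are fixed while n, and
hence L, tends to infinity. *)

(** * Programs with a bound on their running time *)

(** The run is required for every stack [K] of pending programs: this is what lets a
specification of a subprogram be used inside any larger program. *)
Definition wp (P : prog) (T : nat) (Q : store -> Prop) (s : store) : Prop :=
  exists t s', [/\ t <= T, forall K, iter t step (P :: K, s) = (K, s') & Q s'].

Lemma wp_weaken P T T' (Q Q' : store -> Prop) s :
  wp P T Q s -> T <= T' -> (forall s', Q s' -> Q' s') -> wp P T' Q' s.
Proof.
move=> [t [s' [le_t run Qs']]] leT QQ'.
by exists t, s'; split=> //; [apply: leq_trans le_t leT | apply: QQ'].
Qed.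

Lemma wp_const d k (Q : store -> Prop) s :
  Q (set_reg s d k) -> wp (Const d k) 1 Q s.
Proof. by exists 1, (set_reg s d k). Qed.

Lemma wp_add d a b (Q : store -> Prop) s :
  Q (set_reg s d (reg s a + reg s b)) -> wp (Add d a b) 1 Q s.
Proof. by exists 1, (set_reg s d (reg s a + reg s b)). Qed.

Lemma wp_sub d a b (Q : store -> Prop) s :
  Q (set_reg s d (reg s a - reg s b)) -> wp (Sub d a b) 1 Q s.
Proof. by exists 1, (set_reg s d (reg s a - reg s b)). Qed.

Lemma wp_read d a (Q : store -> Prop) s :
  Q (set_reg s d (mem s (reg s a))) -> wp (Read d a) 1 Q s.
Proof. by exists 1, (set_reg s d (mem s (reg s a))). Qed.

Lemma wp_conseq P T (Q Q' : store -> Prop) s :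
  wp P T Q s -> (forall s', Q s' -> Q' s') -> wp P T Q' s.
Proof. by move=> /wp_weaken; apply. Qed.

Lemma wp_timed P T T' (Q : store -> Prop) s :
  wp P T Q s -> T <= T' -> wp P T' Q s.
Proof. by move=> wpP le_T; apply: wp_weaken wpP le_T _. Qed.

Lemma wp_seq P1 P2 T1 T2 (Q : store -> Prop) s :
  wp P1 T1 (wp P2 T2 Q) s -> wp (Seq P1 P2) (T1 + T2).+1 Q s.
Proof.
move=> [t1 [s1 [le1 run1 [t2 [s2 [le2 run2 Q2s]]]]]].
exists (t2 + t1).+1, s2; split=> // [|K]; first by rewrite ltnS addnC leq_add.
by rewrite iterSr iterD /= run1 run2.
Qed.

(** The bound adds the costs of the two branches instead of taking their maximum; the
loss is harmless and keeps the bounds free of case distinctions. *)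
Lemma wp_if a P1 P2 T1 T2 (Q : store -> Prop) s :
  (reg s a != 0 -> wp P1 T1 Q s) -> (reg s a = 0 -> wp P2 T2 Q s) ->
  wp (If a P1 P2) (T1 + T2).+1 Q s.
Proof.
move=> H1 H2; have [a0|a0] := eqVneq (reg s a) 0.
  have [t [s' [le_t run Qs']]] := H2 a0.
  exists t.+1, s'; split=> // [|K]; first by rewrite ltnS (leq_trans le_t) ?leq_addl.
  by rewrite iterSr /= a0 run.
have [t [s' [le_t run Qs']]] := H1 a0.
exists t.+1, s'; split=> // [|K]; first by rewrite ltnS (leq_trans le_t) ?leq_addr.
by rewrite iterSr /= a0 run.
Qed.

Lemma wp_while0 a P (Q : store -> Prop) s :
  reg s a = 0 -> Q s -> wp (While a P) 1 Q s.
Proof. by move=> a0 Qs; exists 1, s; split=> // K /=; rewrite a0. Qed.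

Lemma wp_whileS a P T1 T2 (Q : store -> Prop) s :
  reg s a != 0 -> wp P T1 (wp (While a P) T2 Q) s ->
  wp (While a P) (T1 + T2).+1 Q s.
Proof.
move=> a0 [t1 [s1 [le1 run1 [t2 [s2 [le2 run2 Q2s]]]]]].
exists (t2 + t1).+1, s2; split=> // [|K]; first by rewrite ltnS addnC leq_add.
by rewrite iterSr iterD /= a0 run1 run2.
Qed.

(** Register numbers serve as the frame discipline: a subprogram writes only into
registers from some number [k] on, and callers keep their data below [k]. *)
Definition agree_below (k : nat) (s s' : store) : Prop :=
  (forall r, r < k -> reg s' r = reg s r) /\ mem s' = mem s.

Lemma agree_below_refl k s : agree_below k s s.
Proof. by []. Qed.

Lemma agree_below_trans k s1 s2 s3 :
  agree_below k s1 s2 -> agree_below k s2 s3 -> agree_below k s1 s3.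
Proof.
move=> [r12 m12] [r23 m23]; split=> [r lt_r|]; last by rewrite m23.
by rewrite r23 ?r12.
Qed.

Lemma agree_below_leq k k' s s' :
  k' <= k -> agree_below k s s' -> agree_below k' s s'.
Proof. by move=> le_k [rs ms]; split=> // r /leq_trans/(_ le_k)/rs. Qed.

Lemma agree_below_set k s s' d v :
  k <= d -> agree_below k s s' -> agree_below k s (set_reg s' d v).
Proof.
move=> le_k [rs ms]; split=> //= r lt_r.
by rewrite /upd ltn_eqF ?rs // (leq_trans lt_r).
Qed.

(** Register [i] counts up, and register [i.+1] holds the number of iterations left,
which is recomputed from [lim] after each pass; so the body may overwrite
[i.+1], but must preserve [i] and [lim]. Registers 1 and 2 are expected to hold
the constants 1 and 0. *)
Definition For (i lim : nat) (body : prog) : prog :=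
  Seq (Const i 0) (Seq (Add i.+1 lim 2)
    (While i.+1 (Seq body (Seq (Add i i 1) (Sub i.+1 lim i))))).

(** The accumulators of the loop are the registers from [k] to [i.-1]: those below [k]
are unchanged, and the invariant may not speak of the registers from [i] on,
because the counters and the scratch space of the body are there. *)
Lemma wp_for k i lim body N T (I : nat -> store -> Prop) s :
  lim < k -> 2 < k -> k <= i ->
  reg s 1 = 1 -> reg s 2 = 0 -> reg s lim = N ->
  (forall j s1 s2, agree_below i s1 s2 -> I j s1 -> I j s2) ->
  I 0 s ->
  (forall j s', j < N -> agree_below k s s' -> reg s' i = j -> I j s' ->
     wp body T (fun s2 => [/\ agree_below k s' s2, reg s2 i = j & I j.+1 s2]) s') ->
  wp (For i lim body) (N * (T + 5) + 5)
     (fun s' => agree_below k s s' /\ I N s') s.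
Proof.
move=> lt_lim lt2 le_ki r1 r2 rlim stable I0 Ibody.
have lt_limi := leq_trans lt_lim le_ki; have lt2i := leq_trans lt2 le_ki.
have loop m s1 : m <= N -> agree_below k s s1 -> reg s1 i = N - m ->
    reg s1 i.+1 = m -> I (N - m) s1 ->
    wp (While i.+1 (Seq body (Seq (Add i i 1) (Sub i.+1 lim i))))
       (m * (T + 5) + 1) (fun s' => agree_below k s s' /\ I N s') s1.
  elim: m s1 => [|m IHm] s1 le_m ss1 ri ri1 Im.
    by apply: wp_while0; rewrite // subn0 in Im *.
  have -> : m.+1 * (T + 5) + 1 = ((T + (1 + 1).+1).+1 + (m * (T + 5) + 1)).+1.
    by lia.
  apply: wp_whileS; first by rewrite ri1.
  apply/wp_seq/(@wp_conseq _ _ _ _ _ (Ibody (N - m.+1) _ _ _ _ _)) => //.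
    by lia.
  move=> s2 [s12 r2i I2].
  have ss2 := agree_below_trans ss1 s12.
  apply/wp_seq/wp_add/wp_sub.
  have E : N - m = (N - m.+1).+1 by lia.
  have e1 : reg s2 1 = 1 by rewrite (proj1 ss2) ?r1 ?(ltnW lt2).
  have elim_ : reg s2 lim = N by rewrite (proj1 ss2) ?rlim.
  apply: IHm.
  - exact: ltnW.
  - by apply: agree_below_set; [apply: leq_trans le_ki _|apply: agree_below_set].
  - by rewrite /= /upd eqxx ltn_eqF // r2i e1; lia.
  - rewrite /= /upd eqxx eqxx (ltn_eqF lt_limi) elim_ r2i e1; lia.
  - rewrite E; apply: stable I2; apply: agree_below_set => //.
    by apply: agree_below_set => //; apply: agree_below_refl.
apply: wp_weaken (_ : wp _ (1 + (1 + (N * (T + 5) + 1)).+1).+1 _ _) _ _;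
  [|by lia|by move=> s' Hs'; exact: Hs'].
apply/wp_seq/wp_const/wp_seq/wp_add/loop => //.
- by apply: agree_below_set; [apply: leq_trans le_ki _|apply: agree_below_set].
- by rewrite /= /upd eqxx ltn_eqF // subnn.
- by rewrite /= /upd eqxx (ltn_eqF lt_limi) (ltn_eqF lt2i) rlim r2 addn0.
- rewrite subnn; apply: stable I0; apply: agree_below_set => //.
  by apply: agree_below_set => //; apply: agree_below_refl.
Qed.

(** * Codes of vertex sets and the search program *)

(** The numbering follows the nesting of the subprograms, the inner ones using the
higher registers. Each loop counter is followed by a free number, which is the
second register of its loop. *)
Local Notation r_n := 0 (only parsing).
Local Notation r_one := 1 (only parsing).
Local Notation r_zero := 2 (only parsing).
Local Notation r_two := 3 (only parsing).
Local Notation r_base := 4 (only parsing).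
Local Notation r_log := 5 (only parsing).
Local Notation r_codes := 6 (only parsing).
Local Notation r_best := 7 (only parsing).
Local Notation r_code := 8 (only parsing).
Local Notation r_flip := 10 (only parsing).
Local Notation r_valid := 12 (only parsing).
Local Notation r_size := 13 (only parsing).
Local Notation r_addr := 14 (only parsing).
Local Notation r_v := 15 (only parsing).
Local Notation r_count := 17 (only parsing).
Local Notation r_u := 18 (only parsing).
Local Notation r_digit := 20 (only parsing).
Local Notation r_in := 21 (only parsing).
Local Notation r_rest := 22 (only parsing).
Local Notation r_pos := 23 (only parsing).
Local Notation r_rem := 25 (only parsing).
Local Notation r_quot := 26 (only parsing).
Local Notation r_step := 27 (only parsing).
Local Notation r_tmp := 29 (only parsing).
Local Notation r_aux := 30 (only parsing).

Definition skip : prog := Const r_tmp 0.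

(** Vertex [u] is represented by the digit [u.+1], so that the digit 0 can be used as
padding and a code can list fewer vertices than it has digits. *)
Definition digit (B c i : nat) : nat := (c %/ B ^ i) %% B.

Definition occurs (B N c z : nat) : bool :=
  has (fun i => digit B c i == z) (iota 0 N).

(** [steps] executes a loop-free program symbolically, and [timed] lets it collect
the running time in an existential variable, compared to the claimed bound at
the end. *)
Ltac regs := rewrite /= /upd /=.
Ltac frame := repeat (apply: agree_below_set; first by []);
  first [exact: agree_below_refl | by []].
Ltac timed := eapply wp_timed.
Ltac step1 := first [apply wp_seq | apply wp_const | apply wp_add | apply wp_sub
  | apply wp_read | apply wp_if; regs; let h := fresh "H" in intro h].
Ltac steps := repeat (step1; regs).

(** Euclidean division by repeated subtraction: after [j] passes the quotient is the
minimum of [j] and the true quotient, so any number of passes that is at least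
the dividend will do. The number of codes is a convenient such number. *)
Definition div_prog : prog :=
  Seq (Add r_rem r_rest r_zero) (Seq (Const r_quot 0)
  (For r_step r_codes
    (Seq (Add r_tmp r_rem r_one) (Seq (Sub r_tmp r_tmp r_base)
      (If r_tmp (Seq (Sub r_rem r_rem r_base) (Add r_quot r_quot r_one)) skip))))).

Lemma div_progP s :
  reg s r_one = 1 -> reg s r_zero = 0 -> 0 < reg s r_base ->
  reg s r_rest <= reg s r_codes ->
  wp div_prog (reg s r_codes * 14 + 10)
    (fun s' => [/\ agree_below r_rem s s',
       reg s' r_rem = reg s r_rest %% reg s r_base &
       reg s' r_quot = reg s r_rest %/ reg s r_base]) s.
Proof.
move=> s1 s0 B0 le_x.
set B := reg s r_base in B0 *; set N := reg s r_codes in le_x *.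
set x := reg s r_rest in le_x *.
timed.
  apply/wp_seq/wp_add/wp_seq/wp_const.
  pose I j s' := reg s' r_rem = x - minn j (x %/ B) * B /\
                 reg s' r_quot = minn j (x %/ B).
  apply: wp_conseq (@wp_for r_rem _ _ _ N 9 I _ _ _ _ _ _ _ _ _ _) _ => //.
  - by move=> j s1' s2' [E _] [Ix Iq]; split; rewrite E.
  - by rewrite /I; regs; rewrite !min0n subn0 s0 addn0.
  - move=> j s' lt_j [E m] ri [Ix Iq].
    have le_y : minn j (x %/ B) * B <= x.
      by rewrite (leq_trans _ (leq_divM x B)) // leq_mul // geq_minr.
    have e4 : reg s' r_base = B by rewrite E.
    have e1 : reg s' r_one = 1 by rewrite E.
    have lt_q : (B <= x - minn j (x %/ B) * B) = (j < x %/ B).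
      by rewrite leq_subRL // -mulSnr -leq_divRL // gtn_min ltnn orbF.
    timed.
      steps; (split; [by frame|by []|]); rewrite /I; regs;
        rewrite ?Ix ?Iq ?e4 ?e1 in H *.
        have lt_j' : j < x %/ B by rewrite -lt_q; lia.
        by rewrite !(minn_idPl _) ?(ltnW lt_j') //; split; lia.
      have le_j : x %/ B <= j by rewrite leqNgt -lt_q; lia.
      by rewrite !(minn_idPr _) // (leq_trans le_j).
    by [].
  - move=> s' [fr [Ix Iq]].
    have -> : x %% B = x - x %/ B * B by rewrite {2}(divn_eq x B) addKn.
    rewrite Ix Iq (minn_idPr _) ?(leq_trans (leq_div _ _)) //; split=> //.
    by apply: agree_below_trans fr; frame.
by lia.
Qed.

Definition member_prog : prog :=
  Seq (Add r_in r_flip r_zero) (Seq (Add r_rest r_code r_zero)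
  (For r_pos r_codes
    (Seq div_prog
    (Seq (Sub r_tmp r_rem r_digit) (Seq (Sub r_aux r_digit r_rem)
    (Seq (Add r_tmp r_tmp r_aux)
    (Seq (If r_tmp skip (Sub r_in r_one r_flip))
         (Add r_rest r_quot r_zero)))))))).

(** The registers that stay fixed while one code and one value of the complement
bit are examined. *)
Record ready (B N c : nat) (f : bool) (s : store) : Prop := Ready {
  ready_one : reg s r_one = 1;
  ready_zero : reg s r_zero = 0;
  ready_base : reg s r_base = B;
  ready_codes : reg s r_codes = N;
  ready_code : reg s r_code = c;
  ready_flip : reg s r_flip = f }.

Lemma ready_agree B N c f k s s' :
  r_flip < k -> agree_below k s s' -> ready B N c f s -> ready B N c f s'.
Proof.
move=> lt_k [E _] [? ? ? ? ? ?].
by split; rewrite E // (leq_trans _ lt_k).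
Qed.

Definition member_time (N : nat) : nat := N * (N * 14 + 32) + 10.

Lemma member_progP B N c f z s :
  0 < B -> c <= N -> ready B N c f s -> reg s r_digit = z ->
  wp member_prog (member_time N)
    (fun s' => agree_below r_in s s' /\ reg s' r_in = f (+) occurs B N c z) s.
Proof.
move=> B0 le_c rd sz; have [s1 s0 sB sN sc sf] := rd.
timed.
  apply/wp_seq/wp_add/wp_seq/wp_add.
  pose I j s' := reg s' r_rest = c %/ B ^ j /\
                 reg s' r_in = f (+) occurs B j c z.
  apply: wp_conseq (@wp_for r_in _ _ _ N (N * 14 + 27) I _ _ _ _ _ _ _ _ _ _) _ => //.
  - by move=> j s1' s2' [E _] [Ix Iq]; split; rewrite E.
  - by rewrite /I; regs; rewrite divn1 /= addbF sf sc s0 !addn0.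
  - move=> j s' lt_j fr ri [Ix Ib].
    have {rd} rd : ready B N c f s'.
      by apply: ready_agree fr _ => //; apply: ready_agree rd => //; frame.
    have {sz} sz' : reg s' r_digit = z by rewrite (proj1 fr).
    have {s1 s0 sB sN sc sf} [s1 s0 sB sN sc sf] := rd.
    have le_x : reg s' r_rest <= reg s' r_codes.
      by rewrite Ix sN (leq_trans (leq_div _ _)).
    have occursS : occurs B j.+1 c z = occurs B j c z || (digit B c j == z).
      by rewrite /occurs -addn1 iotaD has_cat /= add0n orbF.
    timed.
      apply/wp_seq; apply: wp_conseq (div_progP _ _ _ le_x) _; rewrite ?sB //.
      move=> s2 [fr2 e2 q2].
      have in2 : reg s2 r_in = reg s' r_in by rewrite (proj1 fr2).
      have [t1 t0 _ _ _ tf] := ready_agree (isT : r_flip < r_rem) fr2 rd.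
      have tz : reg s2 r_digit = z by rewrite (proj1 fr2).
      steps; (split; [| |split]); regs; rewrite ?t0 ?addn0 //; try by
        [ rewrite (proj1 fr2)
        | apply: agree_below_trans (agree_below_leq _ fr2) _ => //; frame
        | rewrite q2 Ix -divnMA expnSr ].
        rewrite in2 Ib occursS /digit -Ix -e2; case: eqP => [E|]; last by rewrite orbF.
        by rewrite E tz subnn in H.
      rewrite t1 tf occursS /digit -Ix -e2.
      have -> : reg s2 r_rem = z by lia.
      by rewrite eqxx orbT; case: (f).
    by rewrite sN; lia.
  - move=> s' [fr [_ ->]]; split=> //.
    by apply: agree_below_trans fr; frame.
by rewrite /member_time; lia.
Qed.

Definition selected (B N c : nat) (f : bool) (u : nat) : bool :=
  f (+) occurs B N c u.+1.

(** The adjacency matrix is read along a row by a pointer that is not reset between rows, which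
avoids the multiplication in the address of an entry. *)
Definition count_prog : prog :=
  Seq (Const r_count 0)
  (For r_u r_n
    (Seq (Add r_digit r_u r_one) (Seq member_prog
    (Seq (Read r_tmp r_addr)
    (Seq (If r_in (Add r_count r_count r_tmp) skip)
         (Add r_addr r_addr r_one)))))).

Definition count_time (n N : nat) : nat := n * (member_time N + 20) + 10.

Lemma count_progP B N c f n a v s :
  0 < B -> c <= N -> ready B N c f s -> reg s r_n = n ->
  reg s r_addr = a -> reg s r_v = v ->
  wp count_prog (count_time n N)
    (fun s' => [/\ agree_below r_addr s s', reg s' r_v = v, reg s' r_addr = a + n &
       reg s' r_count =
         \sum_(0 <= u < n) selected B N c f u * mem s (a + u)]) s.
Proof.
move=> B0 le_c rd sn sa sv.
timed.
  apply/wp_seq/wp_const.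
  pose I j s' := [/\ reg s' r_v = v, reg s' r_addr = a + j &
    reg s' r_count = \sum_(0 <= u < j) selected B N c f u * mem s (a + u)].
  apply: wp_conseq (@wp_for r_addr _ _ _ n (member_time N + 15) I _ _ _ _ _ _ _ _ _ _) _ => //;
    try by case: rd.
  - by move=> j s1' s2' [E _] [? ? ?]; split; rewrite E.
  - by rewrite /I; regs; rewrite addn0 big_geq.
  - move=> j s' lt_j fr ri [Iv Ia Ic].
    have {rd} rd : ready B N c f s'.
      by apply: ready_agree fr _ => //; apply: ready_agree rd => //; frame.
    timed.
      apply/wp_seq/wp_add/wp_seq; apply: wp_conseq (member_progP B0 le_c _ _) _.
      - by apply: ready_agree rd => //; frame.
      - by regs; rewrite ri (ready_one rd) addn1.
      move=> s2 [fr2 in2].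
      have [t1 t0 _ _ _ _] : ready B N c f s2.
        by apply: ready_agree fr2 _ => //; apply: ready_agree rd => //; frame.
      have ta : reg s2 r_addr = a + j by rewrite (proj1 fr2).
      have tm : mem s2 = mem s by rewrite (proj2 fr2) /= (proj2 fr).
      have tc : reg s2 r_count = reg s' r_count by rewrite (proj1 fr2).
      have fr' : agree_below r_addr s' s2.
        by apply: agree_below_trans (agree_below_leq _ fr2) => //; frame.
      steps; (split; [| |split]); regs; rewrite ?t1 ?addn1 ?addnS ?ta ?tm //; try by
        [ rewrite (proj1 fr2)
        | apply: agree_below_trans fr' _; frame ];
        rewrite big_nat_recr //= tc Ic in2 in H *; rewrite /selected.
        by case: (f (+) _) H; rewrite // mul1n.
      by case: (f (+) _) H; rewrite // mul0n addn0.
    by lia.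
  - move=> s' [fr [? ? ?]]; split=> //.
    by apply: agree_below_trans fr; frame.
by rewrite /count_time; lia.
Qed.

(** A set of integers that is finite or co-finite is compiled into the program as a
table of its first values and the constant value after the table; the test
counts down through the table. *)
Fixpoint test_prog (l : seq bool) (b : bool) : prog :=
  if l is x :: l' then
    If r_count (Seq (Sub r_count r_count r_one) (test_prog l' b)) (Const r_tmp x)
  else Const r_tmp b.

Lemma test_progP l b s :
  reg s r_one = 1 ->
  wp (test_prog l b) (size l * 4 + 1)
    (fun s' => agree_below r_count s s' /\ reg s' r_tmp = nth b l (reg s r_count)) s.
Proof.
elim: l s => [|x l IHl] s s1 /=.
  by apply: wp_const; split; [frame | rewrite /= nth_nil].
timed.
  apply: wp_if => Hc.
    apply/wp_seq/wp_sub; apply: wp_conseq (IHl _ _) _ => //.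
    move=> s' [fr ->]; split; first by apply: agree_below_trans fr; frame.
    by regs; rewrite s1; case: (reg s r_count) Hc => // k _; rewrite subn1.
  by apply: wp_const; split; [frame | regs; rewrite Hc].
by lia.
Qed.

Section Check.

Variables (lS : seq bool) (bS : bool) (lR : seq bool) (bR : bool).

Definition check_prog : prog :=
  Seq (Const r_valid 1) (Seq (Const r_size 0) (Seq (Const r_addr 0)
  (For r_v r_n
    (Seq count_prog
    (Seq (Add r_digit r_v r_one) (Seq member_prog
    (Seq (Add r_size r_size r_in)
    (Seq (If r_in (test_prog lS bS) (test_prog lR bR))
         (If r_tmp skip (Const r_valid 0)))))))))).

Definition vertex_ok (n : nat) (M : nat -> nat) (x : nat -> bool) (v : nat) :=
  nth (if x v then bS else bR) (if x v then lS else lR)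
    (\sum_(0 <= u < n) x u * M (v * n + u)).

Definition check_time (n N : nat) : nat :=
  n * (count_time n N + member_time N + size lS * 4 + size lR * 4 + 30) + 15.

Lemma check_progP B N c f n s :
  0 < B -> c <= N -> ready B N c f s -> reg s r_n = n ->
  let x := selected B N c f in
  wp check_prog (check_time n N)
    (fun s' => [/\ agree_below r_valid s s',
       reg s' r_valid = all (vertex_ok n (mem s) x) (iota 0 n) &
       reg s' r_size = \sum_(0 <= v < n) x v]) s.
Proof.
move=> B0 le_c rd sn x.
timed.
  apply/wp_seq/wp_const/wp_seq/wp_const/wp_seq/wp_const.
  pose I j s' := [/\ reg s' r_valid = all (vertex_ok n (mem s) x) (iota 0 j),
    reg s' r_size = \sum_(0 <= v < j) x v & reg s' r_addr = j * n].
  apply: wp_conseq (@wp_for r_valid _ _ _ n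
    (count_time n N + member_time N + size lS * 4 + size lR * 4 + 25)
    I _ _ _ _ _ _ _ _ _ _) _ => //; try by case: rd.
  - by move=> j s1' s2' [E _] [? ? ?]; split; rewrite E.
  - by rewrite /I; regs; rewrite big_geq.
  - move=> j s' lt_j fr ri [Iv Is Ia].
    have {rd} rd : ready B N c f s'.
      by apply: ready_agree fr _ => //; apply: ready_agree rd => //; frame.
    timed.
      have sn' : reg s' r_n = n by rewrite (proj1 fr).
      apply/wp_seq; apply: wp_conseq (count_progP B0 le_c rd sn' Ia ri) _.
      move=> s1 [fr1 v1 a1 c1].
      have rd1 : ready B N c f s1 by apply: ready_agree fr1 _.
      apply/wp_seq/wp_add/wp_seq; apply: wp_conseq (member_progP B0 le_c _ _) _.
      - by apply: ready_agree rd1 => //; frame.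
      - by regs; rewrite v1 (ready_one rd1) addn1.
      move=> s2 [fr2 in2].
      have rd2 : ready B N c f s2.
        by apply: ready_agree fr2 _ => //; apply: ready_agree rd1 => //; frame.
      apply/wp_seq/wp_add/wp_seq.
      set s3 := set_reg _ _ _.
      have fr3 : agree_below r_digit s1 (set_reg s2 r_size (reg s1 r_size)).
        split; last by rewrite /= (proj2 fr2).
        move=> r lt_r; regs; case: eqP => [->//|_].
        by rewrite (proj1 fr2) ?(ltn_trans lt_r) //=; rewrite /upd ltn_eqF.
      have i3 : reg s3 r_in = selected B N c f j by rewrite /s3; regs.
      apply: (@wp_conseq _ _ (fun s4 => agree_below r_count s3 s4 /\
        reg s4 r_tmp = vertex_ok n (mem s) x j)).
        have -> : vertex_ok n (mem s) x j =
          nth (if x j then bS else bR) (if x j then lS else lR) (reg s3 r_count).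
          rewrite /vertex_ok; congr nth.
          have -> : reg s3 r_count = reg s1 r_count by rewrite -(proj1 fr3).
          rewrite c1 (proj2 fr) /=.
          by [].
        have o3 : reg s3 r_one = 1 by rewrite /s3; regs; case: rd2.
        apply: wp_if; rewrite i3 -/(x j) => Hx.
          by case: (x j) Hx => // _; apply: test_progP.
        by case: (x j) Hx => // _; apply: test_progP.
      move=> s4 [fr4 t4].
      have e4 r : r < r_count -> r != r_size -> reg s4 r = reg s1 r.
        move=> lt_r ne_r; rewrite (proj1 fr4) // /s3; regs.
        by rewrite (negbTE ne_r) (proj1 fr2) /= ?/upd ?ltn_eqF //; lia.
      have m4 : mem s4 = mem s' by rewrite (proj2 fr4) /= (proj2 fr2) /= (proj2 fr1).
      have sz4 : reg s4 r_size = \sum_(0 <= v < j.+1) x v.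
        rewrite big_nat_recr //= -Is (proj1 fr4) // /s3; regs.
        by rewrite in2 (proj1 fr2) //= /upd /= (proj1 fr1).
      have agree4 : agree_below r_valid s' s4.
        split=> // r lt_r; rewrite e4 ?(proj1 fr1) //; lia.
      have ad4 : reg s4 r_addr = j.+1 * n by rewrite e4 // a1 addnC -mulSn.
      have va4 : reg s4 r_valid = all (vertex_ok n (mem s) x) (iota 0 j).
        by rewrite e4 // (proj1 fr1).
      have allS : all (vertex_ok n (mem s) x) (iota 0 j.+1) =
          all (vertex_ok n (mem s) x) (iota 0 j) && vertex_ok n (mem s) x j.
        by rewrite -addn1 iotaD all_cat /= andbT.
      rewrite /= in allS.
      (* The flag is cleared if the test has failed, and kept otherwise. *)
      steps; (split; [by apply: agree_below_trans agree4 _; frame| |split]); regs;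
        rewrite ?(e4 r_v) ?v1 ?allS //.
        by rewrite va4; case: (vertex_ok _ _ _ j) t4 H => [_ _|->//]; rewrite andbT.
      by case: (vertex_ok _ _ _ j) t4 H => [->//|_ _]; rewrite andbF.
    by lia.
  - move=> s' [fr [? ? ?]]; split=> //.
    by apply: agree_below_trans fr; frame.
by rewrite /check_time; lia.
Qed.

End Check.

Definition set_of (n : nat) (x : nat -> bool) : {set 'I_n} := [set u : 'I_n | x u]%SET.

Lemma mem_init n (e : rel 'I_n) (v u : 'I_n) :
  mem (init_store e) (v * n + u) = e v u.
Proof.
rewrite /=; congr nat_of_bool; apply/existsP/idP => [[i /existsP[j /andP[/eqP E eij]]]|evu].
  have n0 : 0 < n by apply: leq_ltn_trans (ltn_ord v).
  have Ei := congr1 (divn^~ n) E; have Ej := congr1 (modn^~ n) E.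
  rewrite /= !divnMDl // !divn_small // !addn0 in Ei.
  rewrite /= !modnMDl !modn_small // in Ej.
  by rewrite (val_inj Ei) (val_inj Ej).
by exists v; apply/existsP; exists u; rewrite eqxx.
Qed.

Lemma card_set_of n x : #|set_of n x| = \sum_(0 <= v < n) x v.
Proof.
rewrite big_mkord -sum1_card big_mkcond /=.
by apply: eq_bigr => v _; rewrite inE; case: (x v).
Qed.

Definition decides (l : seq bool) (b : bool) (mu : set nat) : Prop :=
  forall k, nth b l k <-> mu k.

Lemma all_vertex_okP n (e : rel 'I_n) sigma rho lS bS lR bR x :
  decides lS bS sigma -> decides lR bR rho ->
  reflect (sr_set e sigma rho (set_of n x))
    (all (vertex_ok lS bS lR bR n (mem (init_store e)) x) (iota 0 n)).
Proof.
move=> dS dR.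
have okE (v : 'I_n) : vertex_ok lS bS lR bR n (mem (init_store e)) x v =
    nth (if x v then bS else bR) (if x v then lS else lR)
      #|nbrs e v :&: set_of n x|.
  rewrite /vertex_ok; congr nth; rewrite big_mkord -sum1_card.
  rewrite [RHS]big_mkcond; apply: eq_bigr => u _.
  by rewrite mem_init !inE andbC; case: (x u); case: (e v u).
apply: (iffP allP) => [ok v|ok v].
  have := ok v; rewrite mem_iota ltn_ord okE => /(_ isT).
  by rewrite !inE; case: (x v) => okv; split=> // _; [apply/dS | apply/dR].
rewrite mem_iota /= add0n => lt_v; have [okS okR] := ok (Ordinal lt_v).
rewrite (okE (Ordinal lt_v)); move: okS okR; rewrite !inE /=.
by case: (x v) => okS okR; [apply/dS/okS | apply/dR/okR].
Qed.

Definition preferred (opt : objective) (k m : nat) : bool :=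
  if opt is Minimum then k <= m else m <= k.

(** The answer relative to a family [F] of sets; with the solutions among the codes
examined so far as [F], it is the invariant of the search. *)
Definition answer_among (opt : objective) (T : finType) (F : {set T} -> Prop)
    (a : option nat) : Prop :=
  match a with
  | None => forall X, ~ F X
  | Some k => (exists2 X, F X & #|X| = k) /\
      (forall X, F X -> preferred opt k #|X|)
  end.

Lemma eq_answer_among opt (T : finType) (F G : {set T} -> Prop) a :
  (forall X, F X <-> G X) -> answer_among opt F a -> answer_among opt G a.
Proof.
move=> FG; case: a => [k [[X FX eX] kX]|noF X /FG]; last exact: noF.
by split=> [|Y /FG]; [exists X; first exact/FG | apply: kX].
Qed.

(** Solutions are stored as their size plus one, so the initial 0 means that no
solution has been found, as in [encode_answer]. For the maximum this case is covered
by the comparison, 0 being smaller than any stored value. *)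
Definition keep_prog (opt : objective) : prog :=
  let take := Add r_best r_tmp r_zero in
  match opt with
  | Minimum =>
      If r_best (Seq (Sub r_aux r_best r_tmp) (If r_aux take skip)) take
  | Maximum => Seq (Sub r_aux r_tmp r_best) (If r_aux take skip)
  end.

Definition update_prog (opt : objective) : prog :=
  Seq (Add r_tmp r_size r_one) (If r_valid (keep_prog opt) skip).

(** One round of the search extends the family of solutions seen so far, [F], by at
most the current set [X]. *)
Lemma update_progP opt (T : finType) (F : {set T} -> Prop) a (X : {set T}) (b : bool) s :
  reg s r_one = 1 -> reg s r_zero = 0 -> reg s r_best = encode_answer a ->
  reg s r_valid = b -> reg s r_size = #|X| -> answer_among opt F a ->
  wp (update_prog opt) 14
    (fun s' => [/\ agree_below r_best s s', reg s' r_code = reg s r_code,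
       reg s' r_flip = reg s r_flip &
       exists2 a', reg s' r_best = encode_answer a' &
         answer_among opt (fun Y => F Y \/ b /\ Y = X) a']) s.
Proof.
move=> s1 s0 sb sv sz Fa.
have skipP : b = false -> answer_among opt (fun Y => F Y \/ b /\ Y = X) a.
  by move=> ->; apply: eq_answer_among Fa => Y; split=> [|[|[]]] //; left.
have worse k : a = Some k -> preferred opt k #|X| ->
    answer_among opt (fun Y => F Y \/ b /\ Y = X) a.
  move=> ea kX; move: Fa; rewrite ea => -[[Y FY eY] kF]; split.
    by exists Y; [left|].
  by move=> Z [/kF|[_ ->]].
have better : b -> (forall k, a = Some k -> preferred opt #|X| k) ->
    answer_among opt (fun Y => F Y \/ b /\ Y = X) (Some #|X|).
  move=> bT aX; split; first by exists X; [right|].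
  move=> Z [FZ|[_ ->]]; last by rewrite /preferred; case: (opt).
  case: a Fa aX {sb worse skipP} => [k [_ /(_ Z FZ)]|/(_ Z FZ)//].
  rewrite /preferred => h1 /(_ _ erefl).
  by case: (opt) h1 => h1 h2; [apply: leq_trans h2 h1 | apply: leq_trans h1 h2].
timed.
  apply/wp_seq/wp_add/wp_if; regs; rewrite sv => bT; last first.
    apply: wp_const; split; [by frame|by []|by []|exists a => //].
    by apply: skipP; case: (b) bT.
  have {bT} bT : b by case: (b) bT.
  instantiate (1 := 10); rewrite /keep_prog; case: opt {Fa} worse better {skipP} => worse better.
    timed.
      steps; (split; [by frame|by []|by []|]); rewrite ?s1 ?s0 ?sb ?sz ?addn0 ?addn1 in H *.
      - exists (Some #|X|) => //; apply: better => // k ak; move: H0 H.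
        by rewrite sb sz s1 ak /=; lia.
      - exists a => //; case: a sb H H0 worse {better} => // k sb _ H0 worse.
        by apply: worse => //; move: H0; rewrite sb sz s1 /=; lia.
      - exists (Some #|X|) => //; apply: better => // k ak.
        by rewrite ak in H.
    by [].
  timed.
    steps; (split; [by frame|by []|by []|]); rewrite ?s1 ?s0 ?sb ?sz ?addn0 ?addn1 in H *.
    - exists (Some #|X|) => //; apply: better => // k ak.
      by move: H; rewrite ak /=; lia.
    - exists a => //; case: a sb H worse {better} => // k sb H worse.
      by apply: worse => //; move: H; rewrite /=; lia.
  by [].
by [].
Qed.

Definition bit_prog lS bS lR bR opt : prog :=
  Seq (check_prog lS bS lR bR) (update_prog opt).

Definition search_prog lS bS lR bR opt : prog :=
  Seq (Const r_best 0) (For r_code r_codes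
    (For r_flip r_two (bit_prog lS bS lR bR opt))).

Definition decoded (n B N c : nat) (f : bool) : {set 'I_n} :=
  set_of n (selected B N c f).

Definition search_time (lS lR : seq bool) (n N : nat) : nat :=
  N * (2 * (check_time lS lR n N + 20) + 10) + 7.

Lemma search_progP lS bS lR bR sigma rho opt n (e : rel 'I_n) B N s :
  decides lS bS sigma -> decides lR bR rho ->
  0 < B -> reg s r_n = n -> reg s r_one = 1 -> reg s r_zero = 0 ->
  reg s r_two = 2 -> reg s r_base = B -> reg s r_codes = N ->
  mem s = mem (init_store e) ->
  wp (search_prog lS bS lR bR opt) (search_time lS lR n N)
    (fun s' => reg s' r_zero = 0 /\ exists2 a, reg s' r_best = encode_answer a &
      answer_among opt (fun X => sr_set e sigma rho X /\
        exists c f, c < N /\ X = decoded n B N c f) a) s.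
Proof.
move=> dS dR B0 sn s1 s0 s2 sB sN sm.
(* The solutions whose code and complement bit precede [(c, g)] lexicographically. *)
pose F c g X := sr_set e sigma rho X /\
  exists c' (f : bool), (c' < c \/ c' = c /\ f < g) /\ X = decoded n B N c' f.
pose I g c s' := exists2 a, reg s' r_best = encode_answer a &
  answer_among opt (F c g) a.
have F2 c X : F c 2 X <-> F c.+1 0 X.
  split=> -[sX [c' [f [lt_c EX]]]]; split=> //; exists c', f; split=> //.
    by left; case: lt_c => [|[-> _]] //; apply: ltnW.
  case: lt_c => [|[]//]; rewrite ltnS leq_eqVlt => /predU1P[->|lt_c]; last by left.
  by right; split=> //; case: (f).
have stable g c i s1' s2' : r_best < i -> agree_below i s1' s2' -> I g c s1' -> I g c s2'.
  by move=> lt_i [E _] [a Ea Fa]; exists a; rewrite ?E.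
timed.
  apply/wp_seq/wp_const.
  apply: wp_conseq (@wp_for r_best _ _ _ N (2 * (check_time lS lR n N + 20) + 5)
    (I 0) _ _ _ _ _ _ _ _ _ _) _ => //.
  - by move=> j s1' s2' fr Ij; apply: stable fr Ij.
  - by exists None => // X [_ [c' [f [[] // [_]]]]]; case: (f).
  - move=> c s' lt_c fr ri Ic.
    have fr0 : agree_below r_best s s' by apply: agree_below_trans fr; frame.
    timed.
      apply: wp_conseq (@wp_for r_best r_flip _ _ 2 (check_time lS lR n N + 15)
        (fun g s' => reg s' r_code = c /\ I g c s') _ _ _ _ _ _ _ _ _ _) _ => //;
        try by rewrite (proj1 fr).
      + move=> g s1' s2' fr12 [e8 Ig]; split; last by apply: stable fr12 Ig.
        by rewrite (proj1 fr12).
      + move=> g s3 lt_g fr3 rg [rc [a sa Fa]].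
        have fr03 := agree_below_trans fr0 fr3.
        pose f := g == 1.
        have ef : g = f by rewrite /f; move: (g) lt_g => [|[]].
        have rd : ready B N c f s3.
          by split; rewrite -?ef // (proj1 fr03).
        have sn3 : reg s3 r_n = n by rewrite (proj1 fr03).
        timed.
          apply/wp_seq; apply: wp_conseq (check_progP lS bS lR bR B0 (ltnW lt_c) rd sn3) _.
          move=> s4 [fr4 v4 z4].
          have m3 : mem s3 = mem (init_store e) by rewrite (proj2 fr03).
          rewrite m3 -/(selected B N c f) in v4.
          rewrite -card_set_of in z4.
          have [t1 t0 _ _ tc tf] := ready_agree (isT : r_flip < r_valid) fr4 rd.
          have ta : reg s4 r_best = encode_answer a by rewrite (proj1 fr4).
          apply: wp_conseq (update_progP t1 t0 ta v4 z4 Fa) _.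
          move=> s5 [fr5 c5 f5 [a' sa' Fa']]; split.
          * by apply: agree_below_trans fr5; apply: agree_below_leq fr4.
          * by rewrite f5 tf ef.
          * split; first by rewrite c5 tc.
            exists a' => //; apply: eq_answer_among Fa' => X.
            have okP := all_vertex_okP e (selected B N c f) dS dR.
            split=> [[[sX [c' [f' [lt_c' EX]]]]|[/okP ok ->]]|[sX [c' [f' [lt_c' EX]]]]].
            -- split=> //; exists c', f'; split=> //.
               by case: lt_c' => [|[-> lt_f]]; [left|right; split=> //; apply: ltnW].
            -- by split=> //; exists c, f; split=> //; right; rewrite ef.
            -- case: lt_c' => [lt_c'|[ec']].
                 by left; split=> //; exists c', f'; split=> //; left.
               rewrite ltnS leq_eqVlt => /predU1P[|lt_f]; last first.
                 by left; split=> //; exists c', f'; split=> //; right.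
               rewrite ef => ef'; have {}ef' : f' = f by case: (f') ef'; case: (f).
               right; split; last by rewrite EX ec' ef'.
               by apply/okP; rewrite -/(decoded n B N c f) -ef' -ec' -EX.
        by lia.
      + move=> s3 [fr3 [rc [a sa Fa]]]; split=> //.
        by exists a => //; apply: eq_answer_among Fa.
    by lia.
  - move=> s' [fr [a sa Fa]]; split.
      by rewrite (proj1 fr).
    exists a => //; apply: eq_answer_among Fa => X.
    split=> -[sX [c [f [lt_c EX]]]]; split=> //; exists c, f; split=> //.
      by case: lt_c => [|[]].
    by left.
by rewrite /search_time; lia.
Qed.

(** * The number of codes and the whole program *)

(** The number of binary digits of [n], for positive [n]. *)
Definition bitlen (n : nat) : nat := (trunc_log 2 n).+1.

Lemma leq_exp2_bitlen n m : 0 < n -> (2 ^ m <= n) = (m < bitlen n).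
Proof.
move=> n0; rewrite ltnS; apply/idP/idP => [le_n|le_m].
  by apply: trunc_log_max.
by apply: leq_trans (trunc_logP (isT : 1 < 2) n0); rewrite leq_exp2l.
Qed.

Lemma bitlen_leq n : 0 < n -> bitlen n <= n.
Proof.
by move=> n0; apply: leq_trans (trunc_logP (isT : 1 < 2) n0); apply: ltn_expl.
Qed.

Lemma ltn_exp2_bitlen n : n < 2 ^ bitlen n.
Proof. exact: trunc_log_ltn. Qed.

Definition bitlen_prog : prog :=
  Seq (Const r_base 1) (Seq (Const r_log 0)
  (For r_code r_n
    (Seq (Add r_tmp r_n r_one) (Seq (Sub r_tmp r_tmp r_base)
      (If r_tmp (Seq (Add r_base r_base r_base) (Add r_log r_log r_one)) skip))))).

Lemma bitlen_progP n s :
  0 < n -> reg s r_n = n -> reg s r_one = 1 -> reg s r_zero = 0 ->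
  wp bitlen_prog (n * 14 + 10)
    (fun s' => [/\ agree_below r_base s s', reg s' r_base = 2 ^ bitlen n &
       reg s' r_log = bitlen n]) s.
Proof.
move=> n0 sn s1 s0.
timed.
  apply/wp_seq/wp_const/wp_seq/wp_const.
  pose I j s' := reg s' r_base = 2 ^ minn j (bitlen n) /\
                 reg s' r_log = minn j (bitlen n).
  apply: wp_conseq (@wp_for r_base _ _ _ n 9 I _ _ _ _ _ _ _ _ _ _) _ => //.
  - by move=> j s1' s2' [E _] [Ib Il]; split; rewrite E.
  - move=> j s' lt_j fr ri [Ib Il].
    have e0 : reg s' r_n = n by rewrite (proj1 fr).
    have e1 : reg s' r_one = 1 by rewrite (proj1 fr).
    have le_b : (2 ^ minn j (bitlen n) <= n) = (j < bitlen n).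
      by rewrite leq_exp2_bitlen // gtn_min ltnn orbF.
    timed.
      steps; (split; [by frame|by []|]); rewrite /I; regs;
        rewrite ?Ib ?Il ?e0 ?e1 in H *.
        have lt_j' : j < bitlen n by rewrite -le_b; lia.
        by rewrite !(minn_idPl _) ?(ltnW lt_j') // addnn -mul2n -expnS addn1.
      have le_j : bitlen n <= j by rewrite leqNgt -le_b; lia.
      by rewrite !(minn_idPr _) // (leq_trans le_j).
    by [].
  - move=> s' [fr []]; rewrite (minn_idPr _) ?bitlen_leq // => ? ?; split=> //.
    by apply: agree_below_trans fr; frame.
by lia.
Qed.

(** [k] nested loops of [L] passes around a doubling multiply the register by
[2 ^ (L ^ k)]. *)
Fixpoint exp2_prog (i k : nat) : prog :=
  if k is k'.+1 then For i r_log (exp2_prog i.+2 k')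
  else Add r_codes r_codes r_codes.

Lemma exp2_progP i k s :
  r_codes < i -> reg s r_one = 1 -> reg s r_zero = 0 ->
  wp (exp2_prog i k) ((reg s r_log).+1 ^ k * 22 - 11)
    (fun s' => [/\ mem s' = mem s,
       forall r, r < i -> r != r_codes -> reg s' r = reg s r &
       reg s' r_codes = reg s r_codes * 2 ^ (reg s r_log ^ k)]) s.
Proof.
(* A loop adds 5 steps per pass and 5 more, which the subtracted 11 absorbs in the
   induction. *)
elim: k i s => [|k IHk] i s lt_i s1 s0 /=.
  timed; last by instantiate (1 := 1); lia.
  by apply: wp_add; split=> // [r _ ne_r|]; regs; rewrite ?(negbTE ne_r) // muln2 addnn.
set L := reg s r_log.
timed.
  pose I j s' := reg s' r_codes = reg s r_codes * 2 ^ (j * L ^ k) /\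
    forall r, r < i -> r != r_codes -> reg s' r = reg s r.
  apply: wp_conseq (@wp_for r_codes i _ _ L (L.+1 ^ k * 22 - 11) I _ _ _ _ _ _ _ _ _ _) _ => //.
  - exact: ltnW.
  - move=> j s1' s2' [E _] [Ic Ir]; split; first by rewrite E.
    by move=> r lt_r ne_r; rewrite E // Ir.
  - by rewrite /I mul0n muln1.
  - move=> j s' lt_j fr ri [Ic Ir].
    have eL : reg s' r_log = L by rewrite (proj1 fr).
    have lt_i2 : r_codes < i.+2 by lia.
    move: (IHk i.+2 s' lt_i2); rewrite eL (proj1 fr r_one) // (proj1 fr r_zero) //.
    move=> /(_ s1 s0) wpk.
    apply: wp_conseq wpk _ => s2 [m2 r2 c2].
    have e2 r : r < i.+2 -> r != r_codes -> reg s2 r = reg s' r by exact: r2.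
    split.
    + by split=> // r lt_r; rewrite e2 //; lia.
    + by rewrite e2 //; lia.
    + split; first by rewrite c2 Ic -mulnA -expnD mulSn addnC.
      by move=> r lt_r ne_r; rewrite e2 ?Ir //; lia.
  - by move=> s' [fr [Ic Ir]]; split=> //; [exact: (proj2 fr) | rewrite Ic expnS].
have : 0 < L.+1 ^ k by rewrite expn_gt0.
rewrite expnS; move: (L.+1 ^ k) => X; nia.
Qed.

(** All the nested loops are bounded by [n] or [N], hence by [w], and they are nested at
most five deep. *)
Lemma search_time_leq lS lR n N w : 0 < N -> n < w -> N <= w ->
  search_time lS lR n N <= (8 * (size lS + size lR) + 600) * w ^ 5.
Proof.
move=> N0 lt_n le_N; have w0 : 0 < w by apply: leq_ltn_trans lt_n.
move ES : (size lS + size lR) => S.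
have pow i j : i <= j -> w ^ i <= w ^ j by move=> le_ij; rewrite leq_pexp2l.
have pow0 i : 1 <= w ^ i by rewrite expn_gt0 w0.
have mul m a b i : m <= w -> a <= b * w ^ i -> m * a <= b * w ^ i.+1.
  by move=> le_m le_a; rewrite expnS mulnCA leq_mul.
have tm : member_time N <= 56 * w ^ 2.
  have h1 : N * (N * 14 + 32) <= 46 * w ^ 2.
    by apply: mul => //; rewrite expn1; clear -le_N w0; lia.
  by move: h1 (pow0 2); rewrite /member_time; move: (w ^ 2) => W; clear; lia.
have tc : count_time n N <= 86 * w ^ 3.
  have h1 : n * (member_time N + 20) <= 76 * w ^ 3.
    apply: mul; first exact: ltnW.
    by move: tm (pow0 2); move: (w ^ 2) => W; clear; lia.
  by move: h1 (pow0 3); rewrite /count_time; move: (w ^ 3) => W; clear; lia.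
have tk : check_time lS lR n N <= (4 * S + 200) * w ^ 4.
  have h1 : n * (count_time n N + member_time N + size lS * 4 + size lR * 4 + 30)
      <= (4 * S + 172) * w ^ 3.+1.
    apply: mul; first exact: ltnW.
    have : S <= S * w ^ 3 by rewrite leq_pmulr.
    move: tc tm (pow0 3) (pow 2 3 isT); rewrite mulnDl -mulnA -ES.
    by move: (w ^ 3) (w ^ 2) => W W'; move: ((size lS + size lR) * W) => SW; clear; lia.
  move: h1 (pow0 4); rewrite /check_time !(mulnDl (4 * S)).
  by move: (4 * S * w ^ 4) (w ^ 4) => SW W; clear; lia.
have h1 : N * (2 * (check_time lS lR n N + 20) + 10) <= (8 * S + 450) * w ^ 5.
  apply: mul => //; move: tk (pow0 4); rewrite (mulnDl (4 * S)) (mulnDl (8 * S)) -!mulnA.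
  by move: (S * w ^ 4) (w ^ 4) => SW W; clear; lia.
move: h1 (pow0 5); rewrite /search_time !(mulnDl (8 * S)).
by move: (8 * S * w ^ 5) (w ^ 5) => SW W; clear; lia.
Qed.

Section Solve.

Variables (lS : seq bool) (bS : bool) (lR : seq bool) (bR : bool).
Variables (sigma rho : set nat) (opt : objective).

Definition solve_prog : prog :=
  Seq (Const r_one 1) (Seq (Const r_two 2) (Seq bitlen_prog
  (Seq (Const r_codes 1) (Seq (exp2_prog r_code 4)
  (Seq (search_prog lS bS lR bR opt) (Add r_n r_best r_zero)))))).

Definition num_codes (n : nat) : nat := 2 ^ (bitlen n ^ 4).

Definition solve_time (n : nat) : nat :=
  n * 14 + n.+1 ^ 4 * 22 + search_time lS lR n (num_codes n) + 25.

Lemma solve_progP n (e : rel 'I_n) :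
  decides lS bS sigma -> decides lR bR rho -> 0 < n ->
  exists t a, [/\ t <= solve_time n, returns solve_prog e t a &
    answer_among opt (fun X => sr_set e sigma rho X /\
      exists c f, c < num_codes n /\
        X = decoded n (2 ^ bitlen n) (num_codes n) c f) a].
Proof.
move=> dS dR n0.
have [t [s' [le_t run [a sa Fa]]]] : wp solve_prog (solve_time n)
    (fun s' => exists2 a, reg s' r_n = encode_answer a &
      answer_among opt (fun X => sr_set e sigma rho X /\
      exists c f, c < num_codes n /\
        X = decoded n (2 ^ bitlen n) (num_codes n) c f) a) (init_store e).
  timed.
    apply/wp_seq/wp_const/wp_seq/wp_const/wp_seq.
    apply: wp_conseq (@bitlen_progP n _ _ _ _ _) _ => //.
    move=> s1 [fr1 b1 l1]; apply/wp_seq/wp_const/wp_seq.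
    have [q1 z1 t1 n1] : [/\ reg s1 r_one = 1, reg s1 r_zero = 0,
        reg s1 r_two = 2 & reg s1 r_n = n] by rewrite !(proj1 fr1).
    have wexp := @exp2_progP r_code 4 (set_reg s1 r_codes 1) isT q1 z1.
    have el : reg (set_reg s1 r_codes 1) r_log = bitlen n by [].
    rewrite el in wexp; apply: wp_conseq wexp _ => s2 [m2 r2 c2].
    apply/wp_seq; apply: wp_conseq (@search_progP _ _ _ _ _ _ opt n e
      (2 ^ bitlen n) (num_codes n) s2 dS dR _ _ _ _ _ _ _ _) _.
    - exact: (expn_gt0 2 (bitlen n)).
    - by rewrite r2.
    - by rewrite r2.
    - by rewrite r2.
    - by rewrite r2.
    - by rewrite r2.
    - by rewrite c2 mul1n.
    - by rewrite m2 /= (proj2 fr1).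
    move=> s3 [z3 [a sa Fa]]; apply: wp_add; exists a => //.
    by regs; rewrite z3 addn0.
  have : (bitlen n).+1 ^ 4 <= n.+1 ^ 4 by rewrite leq_exp2r // ltnS bitlen_leq.
  by rewrite /solve_time /num_codes; lia.
by exists t, a; split=> //; rewrite /returns run.
Qed.

Lemma solve_time_leq n : 0 < n ->
  solve_time n <= (8 * (size lS + size lR) + 700) * (n.+1 * num_codes n) ^ 5.
Proof.
move=> n0; have N0 : 0 < num_codes n by rewrite expn_gt0.
have lt_n : n < n.+1 * num_codes n by rewrite leq_pmulr.
have le_N : num_codes n <= n.+1 * num_codes n by rewrite leq_pmull.
have := search_time_leq lS lR N0 lt_n le_N.
have : n.+1 ^ 4 <= (n.+1 * num_codes n) ^ 5.
  apply: leq_trans (_ : n.+1 ^ 5 <= _); first by rewrite leq_pexp2l.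
  by rewrite leq_exp2r // leq_pmulr.
have : n.+1 * num_codes n <= (n.+1 * num_codes n) ^ 5.
  by rewrite -[X in X <= _]expn1 leq_pexp2l // muln_gt0.
rewrite /solve_time (mulnDl _ 600) (mulnDl _ 700).
move: (n.+1 ^ 4) (_ ^ 5) (8 * _ * _) (search_time _ _ _ _) lt_n => a b c d.
by move: (n.+1 * _) => w; clear; lia.
Qed.

End Solve.

(** * Small and co-small sets have codes *)

Definition code (B : nat) (l : seq nat) : nat := foldr (fun d c => d + B * c) 0 l.

Lemma digit_code B l i : all (ltn^~ B) l -> digit B (code B l) i = nth 0 l i.
Proof.
elim: l i => [|d l IHl] i /=; first by rewrite /digit div0n mod0n nth_nil.
move=> /andP[lt_d lt_l]; have B0 : 0 < B by apply: leq_ltn_trans lt_d.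
case: i => [|i]; rewrite /digit.
  by rewrite divn1 addnC mulnC modnMDl modn_small.
have E : (d + B * code B l) %/ B = code B l.
  by rewrite addnC mulnC divnMDl // divn_small // addn0.
by rewrite expnS divnMA E; apply: IHl.
Qed.

Lemma ltn_code B l : all (ltn^~ B) l -> code B l < B ^ size l.
Proof.
elim: l => //= d l IHl /andP[lt_d /IHl lt_l].
have : B * (code B l).+1 <= B ^ (size l).+1 by rewrite expnS leq_mul.
by apply: leq_trans; rewrite mulnS ltn_add2r.
Qed.

(** Vertices have nonzero digits, which distinguishes them from the zeros beyond the
end of the list. *)
Lemma occurs_code B N l z : all (ltn^~ B) l -> size l <= N -> 0 < z ->
  occurs B N (code B l) z = (z \in l).
Proof.
move=> lt_l le_N z0; apply/hasP/idP => [[i _ /eqP Ez]|z_l].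
  rewrite digit_code // in Ez; have [lt_i|le_i] := ltnP i (size l).
    by rewrite -Ez mem_nth.
  by rewrite -Ez nth_default in z0.
exists (index z l); last by rewrite digit_code // nth_index.
by rewrite mem_iota (leq_trans _ le_N) // index_mem.
Qed.

Lemma small_set_decoded n B N s (X : {set 'I_n}) :
  1 < B -> n < B -> B ^ s <= N -> #|X| <= s ->
  exists2 c, c < N & X = decoded n B N c false.
Proof.
move=> B1 lt_n le_N le_X; pose l := [seq (val u).+1 | u <- enum X].
have sz : size l <= s by rewrite size_map -cardE.
have lt_l : all (ltn^~ B) l.
  by apply/allP => _ /mapP[u _ ->] /=; apply: leq_trans lt_n; rewrite ltnS.
have le_l : B ^ size l <= N by apply: leq_trans le_N; rewrite leq_exp2l.
exists (code B l); first by apply: leq_trans (ltn_code lt_l) le_l.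
apply/setP => u; rewrite inE /selected /= occurs_code //; last first.
  by apply: leq_trans le_l; apply/ltnW/ltn_expl.
by rewrite mem_map ?mem_enum // => i j [] /val_inj.
Qed.

Lemma cosmall_set_decoded n B N s (X : {set 'I_n}) :
  1 < B -> n < B -> B ^ s <= N -> #|~: X| <= s ->
  exists2 c, c < N & X = decoded n B N c true.
Proof.
move=> B1 lt_n le_N le_X.
have [c lt_c EX] := small_set_decoded B1 lt_n le_N le_X; exists c => //.
apply/setP => u; move/setP: EX => /(_ u); rewrite !inE /selected /=.
by case: (u \in X); case: (occurs _ _ _ _).
Qed.

(** * Solutions in graphs with the mixing property *)

Lemma exists_subset_card (T : finType) (A : {set T}) k :
  k <= #|A| -> exists2 B : {set T}, B \subset A & #|B| = k.
Proof.
move=> /card_geqP[s [Us sz_s sA]]; exists [set x in s]%SET.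
  by apply/fintype.subsetP => x; rewrite inE => /sA.
by rewrite cardsE (card_uniqP Us).
Qed.

(** The only property of random graphs that is needed against large solutions. *)
Definition mixing (T : finType) (e : rel T) (a : nat) : Prop :=
  forall A B : {set T}, #|A| = a -> #|B| = a -> [disjoint A & B] ->
    exists2 u, u \in A & exists2 v, v \in B & e u v.

(** Otherwise [a] vertices of [A] have together at most [a * d.-1] neighbours in [B], and
the remaining vertices of [B], at least [a] of them, contradict mixing. *)
Lemma mixing_degree (T : finType) (e : rel T) a d (A B : {set T}) :
  mixing e a -> 0 < d -> [disjoint A & B] -> a <= #|A| -> a * d <= #|B| ->
  exists2 v, v \in A & d <= #|nbrs e v :&: B|.
Proof.
move=> mix d0 dAB /exists_subset_card[A' sA' cA'] le_B.
have [[v vA dv]|no] := pselect (exists2 v, v \in A & d <= #|nbrs e v :&: B|).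
  by exists v.
pose U := (\bigcup_(v in A') (nbrs e v :&: B))%SET.
have cU : #|U| <= a * d.-1.
  rewrite -cA' -sum_nat_const; apply: leq_trans (_ : \sum_(v in A') #|nbrs e v :&: B| <= _).
    rewrite /U; elim/big_rec2: _ => [|v m W _ le_W]; first by rewrite cards0.
    by rewrite (leq_trans (leq_card_setU _ _)) // leq_add2l.
  apply: leq_sum => v vA'; rewrite -ltnS prednK // ltnNge; apply/negP => dv.
  by apply: no; exists v => //; apply: (fintype.subsetP sA').
have /exists_subset_card[B' sB' cB'] : a <= #|B :\: U|.
  have := cardsID U B; have := subset_leq_card (finset.subsetIr B U).
  have : a * d = a * d.-1 + a by rewrite -mulnSr prednK.
  by lia.
have dAB' : [disjoint A' & B'].
  apply: disjointWl sA' _; apply: disjointWr dAB.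
  by apply: fintype.subset_trans sB' _; apply: finset.subsetDl.
have [u uA [v vB euv]] := mix _ _ cA' cB' dAB'.
have := fintype.subsetP sB' _ vB; rewrite finset.in_setD => /andP[/negP noU vB'].
by case: noU; apply/finset.bigcupP; exists u; rewrite // !inE euv.
Qed.

Definition ultimately (d : nat) (b : bool) (mu : set nat) : Prop :=
  forall k, d <= k -> (mu k <-> b).

(** A large and co-large solution [X] forces [sigma] and [rho] to be co-finite: for
[sigma] split [X] itself into two parts, for [rho] use [X] and its complement, and in
both cases mixing yields a vertex with at least [d] neighbours in [X]. When both
are co-finite, [W] and the whole vertex set are solutions. *)
Lemma extremal_solution (T : finType) (e : rel T) (opt : objective) sigma rho
    a d s bS bR (W X : {set T}) :
  mixing e a -> 0 < d -> a * d.+1 <= s ->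
  #|W| <= s -> (forall v, d <= #|nbrs e v :&: W|) ->
  ultimately d bS sigma -> ultimately d bR rho -> sr_set e sigma rho X ->
  exists2 Y : {set T}, sr_set e sigma rho Y /\ (#|Y| <= s \/ #|~: Y| <= s) &
    preferred opt #|Y| #|X|.
Proof.
move=> mix d0 le_s cW dW evS evR solX.
have prefX : preferred opt #|X| #|X| by rewrite /preferred; case: (opt).
have [small|big] := leqP #|X| s; first by exists X => //; split=> //; left.
have [cosmall|cobig] := leqP #|~: X| s; first by exists X => //; split=> //; right.
have le_ad : a * d <= s by apply: leq_trans le_s; rewrite leq_mul.
have le_a : a <= s by apply: leq_trans le_s; rewrite leq_pmulr.
case: bS evS => evS; last first.
  have [A sA cA] := exists_subset_card (leq_trans le_a (ltnW big)).
  have le_B : a * d <= #|X :\: A|.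
    have := cardsID A X; rewrite (finset.setIidPr sA) cA => E.
    by have := ltnW big; have := mulnSr a d; lia.
  have dA : [disjoint A & X :\: A].
    by rewrite -finset.setI_eq0; apply/eqP/finset.setP => x; rewrite !inE; case: (x \in A).
  have [v vA dv] := mixing_degree mix d0 dA (eq_leq (esym cA)) le_B.
  have dv' : d <= #|nbrs e v :&: X|.
    by apply: leq_trans dv (subset_leq_card _); apply/finset.setIS/finset.subsetDl.
  by have [] := solX v; move=> /(_ (fintype.subsetP sA _ vA)) /(evS _ dv').
case: bR evR => evR; last first.
  have dX : [disjoint ~: X & X] by rewrite -finset.setI_eq0 finset.setIC finset.setICr.
  have [v] := mixing_degree mix d0 dX (leq_trans le_a (ltnW cobig))
                (leq_trans le_ad (ltnW big)).
  by rewrite inE => vX dv; have [_ /(_ vX)/(evR _ dv)] := solX v.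
have solW (Z : {set T}) : (W \subset Z) -> sr_set e sigma rho Z.
  move=> sWZ v; have dv : d <= #|nbrs e v :&: Z|.
    by apply: leq_trans (dW v) (subset_leq_card _); apply: finset.setIS.
  by split=> _; [apply/evS | apply/evR].
case: opt {prefX}.
  exists W; last by rewrite /preferred (leq_trans cW) // ltnW.
  by split; [apply: solW | left].
exists [set: T]%SET; last by rewrite /preferred subset_leq_card // finset.subsetT.
by split; [apply/solW/finset.subsetT | right; rewrite finset.setCT cards0].
Qed.

Lemma answer_extremal opt (T : finType) (e : rel T) sigma rho
    (F : {set T} -> Prop) a :
  (forall X, sr_set e sigma rho X -> exists2 Y, sr_set e sigma rho Y /\ F Y &
     preferred opt #|Y| #|X|) ->
  answer_among opt (fun X => sr_set e sigma rho X /\ F X) a ->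
  sr_answer opt e sigma rho a.
Proof.
move=> ext; case: a => [k [[X [sX FX] eX] best]|noF X /ext[Y /noF]//].
split=> [|Z /ext[Y /best]]; first by exists X.
by rewrite /preferred; case: (opt) => h1 h2; [apply: leq_trans h1 h2 | apply: leq_trans h2 h1].
Qed.

(** * Probabilities in the random graph *)

Local Open Scope ring_scope.

Section Probability.

Variables (R : realType) (p : R) (hp : 0 < p < 1).

Lemma Gnp_weight_ge0 n (E : {set {set 'I_n}}) : 0 <= Gnp_weight p E.
Proof.
by apply: prodr_ge0 => f _; case: ifP => _; case/andP: hp => p0 p1;
  rewrite ?subr_ge0 ltW.
Qed.

(** The weights restricted to the graphs avoiding [F] are again a product over pairs, in
which the weight of the presence of a pair in [F] is 0. *)
Lemma Gnp_no_edge n (F : {set {set 'I_n}}) : F \subset vpairs n ->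
  \sum_(E in powerset (vpairs n) | [disjoint E & F]) Gnp_weight p E
    = (1 - p) ^+ #|F|.
Proof.
move=> sF.
pose present f := if f \in vpairs n then (if f \in F then 0 else p) else 0.
pose absent f := if f \in vpairs n then 1 - p else 1.
transitivity (\prod_f (present f + absent f)); last first.
  rewrite -prodr_const [RHS]big_mkcond; apply: eq_bigr => f _.
  rewrite /present /absent; case: ifP => [_|/negP fV].
    by case: ifP; rewrite ?add0r // addrC subrK.
  by case: ifP => [/(fintype.subsetP sF)//|]; rewrite add0r.
rewrite bigA_distr [RHS](bigID (fun E : {set {set 'I_n}} =>
  (E \in powerset (vpairs n)) && [disjoint E & F])) /=.
rewrite [X in _ = _ + X]big1 ?addr0 => [|E bad]; last first.
  apply/eqP/prodf_eq0; have [f fE bf] : exists2 f, f \in E & (f \notin vpairs n) || (f \in F).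
    move: bad; rewrite negb_and powersetE => /orP[/fintype.subsetPn[f fE fV]|].
      by exists f => //; rewrite fV.
    rewrite -finset.setI_eq0 => /set0Pn[f]; rewrite inE => /andP[fE fF].
    by exists f => //; rewrite fF orbT.
  exists f => //; rewrite fE /present; case: ifP => [fV|//].
  by move: bf; rewrite fV /= => ->.
apply: eq_bigr => E /andP[]; rewrite powersetE => sE dEF.
rewrite /Gnp_weight big_mkcond; apply: eq_bigr => f _.
rewrite /present /absent; case: (boolP (f \in E)) => [fE|fE].
  by rewrite (fintype.subsetP sE) // (disjointFr dEF fE).
by [].
Qed.

Lemma Gnp_total n :
  \sum_(E in powerset (vpairs n)) Gnp_weight p E = 1.
Proof.
rewrite -(expr0 (1 - p)) -(@cards0 {set 'I_n}) -Gnp_no_edge ?finset.sub0set //.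
by apply: eq_bigl => E; rewrite -finset.setI_eq0 finset.setI0 eqxx andbT.
Qed.

Lemma Gnp_Pr_le1 n (Q : rel 'I_n -> Prop) : Gnp_Pr p Q <= 1.
Proof.
rewrite /Gnp_Pr -(Gnp_total n) [leRHS](bigID (fun E => `[< Q (adj E) >])) /=.
by rewrite lerDl sumr_ge0 // => E _; apply: Gnp_weight_ge0.
Qed.

Lemma Gnp_Pr_mono n (Q Q' : rel 'I_n -> Prop) :
  (forall e, Q e -> Q' e) -> Gnp_Pr p Q <= Gnp_Pr p Q'.
Proof.
move=> QQ'; rewrite /Gnp_Pr !big_mkcondr /=; apply: ler_sum => E _.
case: asboolP => [/QQ' Q'E|_]; first by case: asboolP.
by case: ifP => // _; apply: Gnp_weight_ge0.
Qed.

Lemma Gnp_Pr_and n (Q1 Q2 : rel 'I_n -> Prop) :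
  Gnp_Pr p Q1 + Gnp_Pr p Q2 - 1 <= Gnp_Pr p (fun e => Q1 e /\ Q2 e).
Proof.
rewrite lerBlDr -(Gnp_total n) /Gnp_Pr !big_mkcondr -!big_split /=.
apply: ler_sum => E _; have w0 := Gnp_weight_ge0 E.
rewrite asbool_and; case: (asbool (Q1 _)); case: (asbool (Q2 _)) => /=; lra.
Qed.

(** Every bad event used here says that all pairs of some set [F i] are non-edges. *)
Lemma Gnp_union_bound n (I : finType) (P : pred I) (F : I -> {set {set 'I_n}})
    (k : nat) (Q : rel 'I_n -> Prop) :
  (forall i, P i -> F i \subset vpairs n /\ (k <= #|F i|)%N) ->
  (forall E : {set {set 'I_n}}, E \subset vpairs n -> (forall i, P i -> ~~ [disjoint E & F i]) ->
     Q (adj E)) ->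
  1 - #|P|%:R * (1 - p) ^+ k <= Gnp_Pr p Q.
Proof.
move=> PF FQ; have /andP[p0 p1] := hp.
rewrite lerBlDr -[leLHS](Gnp_total n) /Gnp_Pr (bigID (fun E => `[< Q (adj E) >])) /=.
rewrite lerD2l.
apply: (@le_trans _ _ (\sum_(i | P i) (1 - p) ^+ #|F i|)); last first.
  rewrite mulr_natl -sumr_const; apply: ler_sum => i Pi.
  by apply: ler_wiXn2l; rewrite ?subr_ge0 ?gerBl ?ltW //; case: (PF i Pi).
rewrite -(eq_bigr _ (fun i Pi => Gnp_no_edge (proj1 (PF i Pi)))).
rewrite (exchange_big_dep (fun E : {set {set 'I_n}} => E \in powerset (vpairs n))) /=; last first.
  by move=> i E _ /andP[].
rewrite big_mkcondr; apply: ler_sum => E; rewrite powersetE => sE.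
case: asboolP => /= [_|nQ]; first by apply: sumr_ge0 => i _; apply: Gnp_weight_ge0.
have [i Pi dEF] : exists2 i, P i & [disjoint E & F i].
  apply: contrapT => no; apply: nQ; apply: FQ => // i Pi.
  by apply/negP => dEF; apply: no; exists i.
rewrite (bigD1 i) /=; last by rewrite Pi sE.
by rewrite lerDl sumr_ge0 // => j _; apply: Gnp_weight_ge0.
Qed.

End Probability.

Local Open Scope nat_scope.

Lemma leq_bin_exp n k : 'C(n, k) <= n ^ k.
Proof.
apply: leq_trans (_ : n ^_ k <= _).
  by rewrite -bin_ffact leq_pmulr // fact_gt0.
elim: k => // k IHk; rewrite ffactnSr expnSr leq_mul //.
exact: leq_subr.
Qed.

Lemma set2_inj_disjoint (T : finType) (A B : {set T}) (u v u' v' : T) :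
  [disjoint A & B] -> u \in A -> u' \in A -> v \in B -> v' \in B ->
  [set u; v]%SET = [set u'; v']%SET -> u = u' /\ v = v'.
Proof.
move=> dAB uA u'A vB v'B E.
have neq x y : x \in A -> y \in B -> x != y.
  by move=> xA yB; apply/eqP => exy; rewrite -exy (disjointFr dAB xA) in yB.
split.
  have := finset.set21 u v; rewrite E !inE (negbTE (neq _ _ uA v'B)) orbF.
  by move/eqP.
have := finset.set22 u v; rewrite E !inE [v == u']eq_sym.
by rewrite (negbTE (neq _ _ u'A vB)) => /eqP.
Qed.

Lemma pair_in_vpairs n (u v : 'I_n) : u != v -> [set u; v]%SET \in vpairs n.
Proof. by rewrite inE cards2 => ->. Qed.

Definition block (n b j : nat) : {set 'I_n} := [set u : 'I_n | u %/ b == j]%SET.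

Lemma card_block n b j : 0 < b -> j.+1 * b <= n -> b <= #|block n b j|.
Proof.
move=> b0 le_n.
have lt_n (k : 'I_b) : j * b + k < n.
  by apply: leq_trans le_n; rewrite mulSn addnC ltn_add2r.
have inj : injective (fun k => Ordinal (lt_n k)).
  by move=> k k' [/addnI/val_inj].
rewrite -[leqLHS]card_ord -(card_imset _ inj); apply: subset_leq_card.
apply/fintype.subsetP => _ /imsetP[k _ ->]; rewrite inE /=.
by rewrite divnMDl // divn_small // addn0.
Qed.

(** The blocks are disjoint, so a neighbour in each of [d] blocks gives [d] neighbours in
their union. *)
Lemma dominated_by_blocks n (e : rel 'I_n) b d : 0 < b ->
  (forall v (j : 'I_d), exists2 u, u \in block n b j & e v u) ->
  exists2 W : {set 'I_n}, #|W| <= d * b & forall v, d <= #|nbrs e v :&: W|.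
Proof.
move=> b0 dom; exists [set u : 'I_n | u < d * b]%SET => [|v].
  rewrite cardE -(size_map val) -[leqRHS](size_iota 0).
  apply: uniq_leq_size; first by rewrite (map_inj_uniq val_inj) enum_uniq.
  by move=> _ /mapP[u uW ->]; rewrite mem_iota /=; rewrite mem_enum inE in uW.
have ex (j : 'I_d) : {u | (u \in block n b j) && e v u}.
  by apply: sigW; have [u uj evu] := dom v j; exists u; rewrite uj.
pose f j := sval (ex j).
have fP j : f j %/ b = j /\ e v (f j).
  by have /andP[] := svalP (ex j); rewrite inE => /eqP.
have inj : injective f.
  move=> i j eij; apply: val_inj; rewrite /= -(proj1 (fP i)) -(proj1 (fP j)).
  by rewrite eij.
rewrite -[leqLHS]card_ord -(card_imset _ inj); apply: subset_leq_card.
apply/fintype.subsetP => _ /imsetP[j _ ->]; rewrite !inE (proj2 (fP j)) /=.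
by rewrite -ltn_divLR // (proj1 (fP j)).
Qed.

Local Open Scope ring_scope.

Section RandomGraph.

Variables (R : realType) (p : R) (hp : 0 < p < 1).

(** For disjoint [A] and [B] of size [a] there are [a * a] pairs between them, and they
are all absent with probability [(1 - p) ^+ (a * a)]. *)
Lemma Gnp_mixing n a :
  1 - (n ^ (2 * a))%:R * (1 - p) ^+ (a * a) <= Gnp_Pr p (fun e : rel 'I_n => mixing e a).
Proof.
pose P (AB : {set 'I_n} * {set 'I_n}) :=
  [&& #|AB.1| == a, #|AB.2| == a & [disjoint AB.1 & AB.2]].
pose F (AB : {set 'I_n} * {set 'I_n}) :=
  [set [set uv.1; uv.2]%SET | uv in finset.setX AB.1 AB.2]%SET.
apply: le_trans (Gnp_union_bound hp (P := P) (F := F) (k := (a * a)%N) _ _).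
- rewrite lerD2l lerN2 ler_wpM2r //.
    by apply: exprn_ge0; case/andP: hp => p0 p1; rewrite subr_ge0 ltW.
  rewrite ler_nat mul2n -addnn expnD.
  apply: (@leq_trans ('C(n, a) * 'C(n, a))); last by rewrite leq_mul // leq_bin_exp.
  rewrite -[X in 'C(X, _)](card_ord n) -card_draws -cardsX subset_leq_card //.
  by apply/fintype.subsetP => -[A B] /and3P[/= cA cB dAB]; rewrite !inE cA.
- move=> [A B] /and3P[/= /eqP cA /eqP cB dAB]; split.
    apply/fintype.subsetP => f /imsetP[[u v]]; rewrite inE => /andP[/= uA vB] ->.
    by apply: pair_in_vpairs; apply/eqP => euv; rewrite -euv (disjointFr dAB uA) in vB.
  rewrite card_in_imset ?cardsX /= ?cA ?cB //.
  move=> [u v] [u' v']; rewrite !inE /= => /andP[uA vB] /andP[u'A v'B].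
  by case/(set2_inj_disjoint dAB uA u'A vB v'B) => -> ->.
- move=> E sE hit A B cA cB dAB.
  have := hit (A, B); rewrite /P /= cA cB dAB !eqxx => /(_ isT).
  rewrite -finset.setI_eq0 => /set0Pn[f]; rewrite inE => /andP[fE /imsetP[[u v]]].
  rewrite inE => /andP[/= uA vB] ef; exists u => //; exists v => //.
  by rewrite /adj -ef.
Qed.

(** The blocks have [b.+1] elements because the vertex [v] itself may be one of them,
which leaves [b] possible neighbours. *)
Lemma Gnp_blocks n b d : (d * b.+1 <= n)%N ->
  1 - (n * d)%:R * (1 - p) ^+ b <= Gnp_Pr p (fun e : rel 'I_n =>
    forall v (j : 'I_d), exists2 u, u \in block n b.+1 j & e v u).
Proof.
move=> le_n; pose F (vj : 'I_n * 'I_d) :=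
  [set [set vj.1; u]%SET | u in block n b.+1 vj.2 :\ vj.1]%SET.
apply: le_trans (Gnp_union_bound hp (P := predT) (F := F) (k := b) _ _).
- by rewrite card_prod !card_ord.
- move=> [v j] _; split.
    apply/fintype.subsetP => f /imsetP[u]; rewrite !inE => /andP[uv _] ->.
    by have := pair_in_vpairs uv; rewrite finset.setUC inE.
  rewrite card_in_imset /=; last first.
    move=> u u'; rewrite !inE => /andP[uv _] /andP[u'v _].
    move=> E; have := finset.set22 v u; rewrite E !inE (negbTE uv).
    by move/eqP.
  have := @card_block n b.+1 j isT; rewrite (leq_trans _ le_n) ?leq_mul //.
  move=> /(_ isT) le_b; rewrite -ltnS (leq_trans le_b) //.
  by rewrite (cardsD1 v); apply: leq_add (leq_b1 _) (leqnn _).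
- move=> E sE hit v j; have := hit (v, j) isT.
  rewrite -finset.setI_eq0 => /set0Pn[f]; rewrite inE => /andP[fE /imsetP[u]].
  by rewrite !inE => /andP[_ uj] ef; exists u; rewrite ?inE // /adj -ef.
Qed.

(** Mixing says nothing about single vertices, so the existence of a small set in which
all degrees are at least [d] is a separate requirement. *)
Definition typical n (e : rel 'I_n) (a d s : nat) : Prop :=
  mixing e a /\
  exists2 W : {set 'I_n}, (#|W| <= s)%N & forall v, (d <= #|nbrs e v :&: W|)%N.

(** With [r = 1 - p], mixing fails with probability at most
[(2 ^ L) ^ (2 L^2) * r ^ (L^4) = (4 r^L) ^ (L^3)], and some block misses the
neighbourhood of some vertex with probability at most [d * (2 r^L) ^ L]. Both are
controlled by [2^-L <= 1 / n.+1]. *)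
Lemma Gnp_typical n d L : (0 < L)%N -> (n.+1 <= 2 ^ L)%N ->
  (d * (L * L).+1 <= n)%N -> (1 - p) ^+ L <= 8^-1 ->
  1 - d.+1%:R / n.+1%:R <= Gnp_Pr p (fun e : rel 'I_n => typical e (L * L) d (d * (L * L).+1)).
Proof.
move=> L0 lt_n le_n small; have /andP[p0 p1] := hp.
set r := 1 - p in small; have r0 : 0 <= r by rewrite subr_ge0 ltW.
have le_half k l : (k <= l)%N -> 2^-1 ^+ l <= 2^-1 ^+ k :> R.
  by move=> le_kl; rewrite ler_wiXn2l // invf_le1 // ler1n.
have inv_n : 2^-1 ^+ L <= n.+1%:R^-1 :> R.
  by rewrite exprVn lef_pV2 ?posrE ?exprn_gt0 // -natrX ler_nat.
have le_2L k : (n ^ k)%:R <= (2 ^+ L) ^+ k :> R.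
  case: k => [|k]; first by rewrite expn0 expr0.
  by rewrite -!natrX ler_nat leq_exp2r // ltnW.
have mix : (n ^ (2 * (L * L)))%:R * r ^+ (L * L * (L * L)) <= n.+1%:R^-1.
  apply: le_trans inv_n.
  apply: le_trans (_ : (4 * r ^+ L) ^+ (L * (L * L)) <= _).
    have -> : (4 * r ^+ L) ^+ (L * (L * L)) =
        4 ^+ (L * (L * L)) * r ^+ (L * L * (L * L)).
      by rewrite exprMn -exprM !mulnA.
    apply: ler_wpM2r; first exact: exprn_ge0.
    apply: le_trans (le_2L _) _; rewrite -exprM.
    by rewrite (_ : 4 = 2 ^+ 2 :> R) -?exprM ?expr2 -?natrM // mulnCA mulnA.
  apply: le_trans (le_half L (L * (L * L))%N _); last by rewrite leq_pmulr // muln_gt0 L0.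
  by apply: lerXn2r; rewrite ?nnegrE ?mulr_ge0 ?invr_ge0 ?exprn_ge0 //; lra.
have dom : (n * d)%:R * r ^+ (L * L) <= d%:R / n.+1%:R.
  rewrite natrM mulrC mulrA (mulrC _ d%:R) ; apply: ler_wpM2l => //.
  apply: le_trans inv_n.
  apply: le_trans (_ : (2 * r ^+ L) ^+ L <= _); last first.
    by apply: lerXn2r; rewrite ?nnegrE ?mulr_ge0 ?invr_ge0 ?exprn_ge0 //; lra.
  rewrite exprMn -exprM mulrC ler_wpM2r ?exprn_ge0 //.
  by have := le_2L 1%N; rewrite expn1 expr1.
have b1 := Gnp_mixing n (L * L).
have b2 := Gnp_blocks le_n.
apply: le_trans (Gnp_Pr_mono (Q := fun e : rel 'I_n => mixing e (L * L) /\
  forall v (j : 'I_d), exists2 u, u \in block n (L * L).+1 j & e v u) hp _); last first.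
  by move=> e [me be]; split=> //; apply: dominated_by_blocks.
apply: le_trans (Gnp_Pr_and hp _ _).
have combine (x y u v u' v' : R) :
    u <= u' -> v <= v' -> 1 - u <= x -> 1 - v <= y -> 1 - (v' + u') <= x + y - 1.
  by lra.
by rewrite -natr1 mulrDl mul1r; apply: combine mix dom b1 b2.
Qed.

End RandomGraph.

(** * The parameter of the exponent and the time budget *)

Local Open Scope nat_scope.

Lemma fin_or_cofin_ultimately mu : fin_or_cofin mu ->
  exists d b, forall d', d <= d' -> ultimately d' b mu.
Proof.
have bounded (A : set nat) : finite_set A -> exists d, forall k, A k -> k < d.
  move=> /finite_seqP[l ->]; exists (\max_(k <- l) k).+1 => k /= kl.
  by rewrite ltnS; apply: leq_bigmax_seq.
case=> /bounded[d lt_d]; exists d; [exists false|exists true] => d' le_d k le_k.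
  by split=> // /lt_d; rewrite ltnNge (leq_trans le_d).
split=> // _; apply: contrapT => /lt_d.
by rewrite ltnNge (leq_trans le_d).
Qed.

Definition table (d : nat) (mu : set nat) : seq bool := mkseq (fun k => `[< mu k >]) d.

Lemma decides_table d b mu : ultimately d b mu -> decides (table d mu) b mu.
Proof.
move=> evb k; have [lt_k|le_k] := ltnP k d.
  by rewrite nth_mkseq //; split=> /asboolP.
by rewrite nth_default ?size_mkseq //; split=> /(evb k le_k).
Qed.

Local Open Scope ring_scope.

Lemma max_of_fin (A : set nat) : finite_set A ->
  exists M : int, [/\ max_of A = M%:E, -1 <= M & (A !=set0)%classic -> 0 <= M].
Proof.
move=> finA; rewrite /max_of asboolT //.
eexists; split; first by [].
- exact: bigmax_ge_id.
- move=> [x Ax]; apply: (@le_trans _ _ x%:Z) => //.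
  by apply: (Order.TotalTheory.le_bigmax_seq _ x) => //; rewrite in_fset_set // inE.
Qed.

Lemma max_of_infin (A : set nat) : ~ finite_set A -> max_of A = +oo%E.
Proof. by move=> infA; rewrite /max_of asboolF. Qed.

Lemma infinite_setC (A : set nat) : finite_set A -> ~ finite_set (~` A)%classic.
Proof.
move=> finA finC; apply: infinite_nat.
by rewrite -(setUv A) finite_setU.
Qed.

Definition trivial_set (mu : set nat) : Prop := mu = setT \/ mu = set0.

Lemma d_of_trivial mu : trivial_set mu -> d_of mu = 0.
Proof.
case=> ->; rewrite /d_of; first by rewrite asboolT.
rewrite asboolF; last by move=> E; have : [set: nat]%classic 0%N by []; rewrite -E.
rewrite [max_of set0]/max_of asboolT // fset_set0 big_nil.
by rewrite max_of_infin ?miney //; apply: infinite_setC.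
Qed.

Lemma d_of_nontrivial mu : fin_or_cofin mu -> ~ trivial_set mu -> 1 <= d_of mu.
Proof.
move=> fc /not_orP[neT ne0]; rewrite /d_of asboolF //.
rewrite -[leLHS]addr0 lerD2l; case: fc => fin.
  have [M [-> _ M0]] := max_of_fin fin.
  rewrite max_of_infin ?miney; last exact: infinite_setC.
  by apply: M0; apply/set0P/eqP.
have [M [-> _ M0]] := max_of_fin fin.
rewrite max_of_infin ?minye; last by rewrite -{1}(setCK mu); apply: infinite_setC.
apply: M0; apply/set0P/eqP => E; apply: neT.
by rewrite -(setCK mu) E setC0.
Qed.

(** The constraints alone determine the set to be empty, full or arbitrary, unless both
constraints are unsatisfiable. *)
Lemma trivial_solution opt (sigma rho : set nat) :
  trivial_set sigma -> trivial_set rho ->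
  exists P : prog, forall n (e : rel 'I_n), (0 < n)%N ->
    exists a, returns P e 3 a /\ sr_answer opt e sigma rho a.
Proof.
have setT0 n (e : rel 'I_n) (X : {set 'I_n}) : sr_set e setT set0 X <-> X = [set: 'I_n]%SET.
  split=> [sX|->]; last by move=> v; rewrite inE.
  by apply/finset.setP => v; rewrite inE; apply/negPn/negP => /(proj2 (sX v)).
have set0T n (e : rel 'I_n) (X : {set 'I_n}) : sr_set e set0 setT X <-> X = finset.set0.
  split=> [sX|->]; last by move=> v; rewrite inE.
  by apply/finset.setP => v; rewrite inE; apply/negP => /(proj1 (sX v)).
move=> [->|->] [->|->].
- case: opt.
    exists (Const 0 1) => n e n0; exists (Some 0%N); split=> //=.
    by split=> //; exists finset.set0; [|rewrite cards0].
  exists (Seq (Const 1 1) (Add 0 0 1)) => n e n0; exists (Some n); split=> /=.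
    by split=> //=; rewrite /upd /= addn1.
  split; first by exists [set: 'I_n]%SET; rewrite // cardsT card_ord.
  by move=> X _; rewrite -[leqRHS]card_ord max_card.
- exists (Seq (Const 1 1) (Add 0 0 1)) => n e n0; exists (Some n); split=> /=.
    by split=> //=; rewrite /upd /= addn1.
  split; first by exists [set: 'I_n]%SET; rewrite ?setT0 // cardsT card_ord.
  by move=> X /setT0 ->; rewrite cardsT card_ord; case: (opt).
- exists (Const 0 1) => n e n0; exists (Some 0%N); split=> //=.
  split=> //; first by exists finset.set0; [rewrite set0T|rewrite cards0].
  by move=> X /set0T ->; rewrite cards0; case: (opt).
- exists (Const 0 0) => n e n0; exists None; split=> //= X sX.
  by have [] := sX (Ordinal n0); case: (_ \in X) => [/(_ isT)|_ /(_ isT)].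
Qed.

(** [2 ^ bitlen n <= 2 n <= n ^ 2]. *)
Lemma bitlen_ln (R : realType) n : (1 < n)%N ->
  (bitlen n)%:R <= 2 / ln 2 * ln n%:R :> R.
Proof.
move=> n1; have ln2 : 0 < ln 2 :> R by rewrite ln_gt0 // ltr1n.
rewrite mulrAC ler_pdivlMr // !mulr_natl.
rewrite -!lnXn ?ltr0n // ?(ltnW n1) //.
rewrite ler_ln ?posrE ?exprn_gt0 ?ltr0n ?(ltnW n1) // -!natrX ler_nat.
rewrite /bitlen expnS -mulnn; apply: leq_mul => //.
by apply: trunc_logP => //; apply: ltnW.
Qed.

(** The running time contains the fifth power of the number of codes,
[2 ^ (5 * bitlen n ^ 4)], and [bitlen n] is at most [2 / ln 2] times [ln n]. *)
Lemma num_codes_budget (R : realType) (d : int) n : (1 < n)%N -> 1 <= d ->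
  (num_codes n)%:R ^+ 5 <= 2 `^ (5 * (2 / ln 2) ^+ 4 * d%:~R * ln n%:R ^+ 4) :> R.
Proof.
move=> n1 d1; have ln2 : 0 < ln 2 :> R by rewrite ln_gt0 // ltr1n.
have lnn : 0 < ln n%:R :> R by rewrite ln_gt0 // ltr1n.
rewrite /num_codes natrX -exprM -powR_mulrn //; apply: ler_powR; first by rewrite ler1n.
have d1' : 1 <= d%:~R :> R by rewrite ler1z.
have c0 : 0 <= 2 / ln 2 * ln n%:R :> R.
  by apply: mulr_ge0; [apply: divr_ge0 => //|]; apply: ltW.
have le_L : (bitlen n)%:R ^+ 4 <= (2 / ln 2 * ln n%:R) ^+ 4 :> R.
  apply: lerXn2r; rewrite ?nnegrE //.
  exact: bitlen_ln.
have -> : 5 * (2 / ln 2) ^+ 4 * d%:~R * ln n%:R ^+ 4 =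
    5 * ((2 / ln 2 * ln n%:R) ^+ 4 * d%:~R) :> R.
  by rewrite [(_ * ln n%:R) ^+ 4]exprMn; move: (_ ^+ 4) (_ ^+ 4) => x y; ring.
rewrite mulnC natrM natrX ler_wpM2l //; apply: le_trans le_L _.
by rewrite ler_peMr // exprn_ge0.
Qed.

Section Final.

Variables (R : realType) (p : R) (hp : 0 < p < 1).

Lemma almost_surely_rate (Q : forall n, rel 'I_n -> Prop) (c : R) n0 :
  (forall n, (n0 <= n)%N -> 1 - c / n.+1%:R <= Gnp_Pr p (@Q n)) ->
  almost_surely p Q.
Proof.
move=> rate; rewrite /almost_surely.
have lower : ((fun n => 1 - c * harmonic n) @ \oo --> (1 - c * 0 : R))%classic.
  by apply: cvgB; [exact: cvg_cst | apply: cvgMr; apply: cvg_harmonic].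
rewrite mulr0 subr0 in lower.
apply: (squeeze_cvgr _ lower (cvg_cst (1 : R))).
near=> n; rewrite Gnp_Pr_le1 // andbT /harmonic; apply: rate.
by near: n; exists n0.
Unshelve. all: by end_near.
Qed.

Lemma bitlen_large (L0 : nat) : forall n, (2 ^ L0 <= n)%N -> (L0 <= bitlen n)%N.
Proof.
move=> n le_n; have n0 : (0 < n)%N by apply: leq_trans le_n; rewrite expn_gt0.
by apply: ltnW; rewrite -leq_exp2_bitlen.
Qed.

Lemma exp_small : exists L0, forall L, (L0 <= L)%N -> (1 - p) ^+ L <= 8^-1.
Proof.
have /andP[p0 p1] := hp.
have r1 : `|1 - p| < 1 by rewrite ger0_norm; lra.
have /cvgrPdist_le/(_ 8^-1) := cvg_expr r1.
rewrite invr_gt0 ltr0n => /(_ isT)[L0 _ small]; exists L0 => L le_L.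
have := small L le_L; rewrite /= sub0r normrN; apply: le_trans; exact: ler_norm.
Qed.

End Final.

(** * The algorithm on random graphs *)

Lemma Gnp_Pr_sure (R : realType) (p : R) n (Q : rel 'I_n -> Prop) :
  (forall e, Q e) -> Gnp_Pr p Q = 1.
Proof.
move=> allQ; rewrite -(Gnp_total p n); apply: eq_bigl => E.
by rewrite asboolT // andbT.
Qed.

Local Open Scope nat_scope.

(** Since [2 ^ (bitlen n).-1 <= n], this makes the graph larger than [bitlen n ^ 3], hence
large enough to contain the blocks. The bound 12 is sharp: the inequality fails from 2
to 11. *)
Lemma cube_leq_exp2 k : 12 <= k -> k ^ 3 <= 2 ^ k.-1.
Proof.
move=> /subnK <-; elim: (k - 12) => [|i IHi]; first by vm_compute.
rewrite (_ : (i.+1 + 12).-1 = (i + 12).-1.+1); last by lia.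
rewrite (expnS 2); apply: (@leq_trans (2 * (i + 12) ^ 3)); last by rewrite leq_mul2l IHi.
rewrite addSn; have : 12 <= i + 12 by rewrite leq_addl.
by move: (i + 12) => m le_m; rewrite !expnS !expn0; nia.
Qed.

(** The hypothesis [2 * d <= L] makes both [L^2 (d + 1)] and [d (L^2 + 1)] at most [L^3],
the size up to which all sets and their complements have codes. *)
Lemma typical_solves opt sigma rho bS bR d n (e : rel 'I_n) :
  let L := bitlen n in
  0 < n -> 0 < d -> 2 * d <= L -> ultimately d bS sigma -> ultimately d bR rho ->
  typical e (L * L) d (d * (L * L).+1) ->
  exists t a, [/\
    t <= (8 * (d + d) + 700) * (n.+1 * num_codes n) ^ 5,
    returns (solve_prog (table d sigma) bS (table d rho) bR opt) e t a &
    sr_answer opt e sigma rho a].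
Proof.
move=> L n0 d0 le_dL evS evR [mix [W cW dW]].
have [t [a [le_t run ans]]] :=
  solve_progP opt e (decides_table evS) (decides_table evR) n0.
exists t, a; split=> //.
  by apply: leq_trans le_t (leq_trans (solve_time_leq _ _ _) _); rewrite ?size_mkseq.
apply: answer_extremal ans => X solX.
have L0 : 0 < L by [].
have L2 : 0 < L * L by rewrite muln_gt0 L0.
have le_s : L * L * d.+1 <= L ^ 3.
  by rewrite expnSr leq_mul //; lia.
have le_W : #|W| <= L ^ 3.
  apply: leq_trans cW _; apply: leq_trans (_ : d * (2 * (L * L)) <= _).
    by rewrite leq_mul // mul2n -addnn -addn1 leq_add2l.
  by rewrite mulnA (mulnC d) expnS -mulnn leq_mul.
have [Y [solY smallY] prefY] := extremal_solution opt mix d0 le_s le_W dW evS evR solX.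
exists Y => //; split=> //.
have B1 : 1 < 2 ^ L by rewrite -[1](expn0 2) ltn_exp2l.
have lt_n := ltn_exp2_bitlen n.
have le_N : (2 ^ L) ^ (L ^ 3) <= num_codes n by rewrite -expnM -expnS.
case: smallY => cY.
  by have [c lt_c EY] := small_set_decoded B1 lt_n le_N cY; exists c, false.
by have [c lt_c EY] := cosmall_set_decoded B1 lt_n le_N cY; exists c, true.
Qed.

Local Open Scope ring_scope.

Theorem corollary2 (R : realType) (p : R) (hp : 0 < p < 1) (opt : objective) :
  exists C : R,
    forall sigma rho : set nat, fin_or_cofin sigma -> fin_or_cofin rho ->
    exists (P : prog) (q : {poly R}),
      almost_surely p (fun n =>
        solves_in_time P opt sigma rho
          (q.[n%:R] * 2 `^ (C * (d_sr sigma rho)%:~R * ln n%:R ^+ 4))).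
Proof.
exists (5 * (2 / ln 2) ^+ 4) => sigma rho fS fR.
have [[tS tR]|nontrivial] := pselect (trivial_set sigma /\ trivial_set rho).
  have [P solP] := trivial_solution opt tS tR; exists P, 3%:P.
  apply: (@almost_surely_rate _ _ hp _ 0 1) => n n0.
  rewrite mul0r subr0 Gnp_Pr_sure // => e.
  have [a [run ans]] := solP n e n0; exists 3, a; split=> //.
  by rewrite /d_sr !d_of_trivial // maxxx mulr0 mul0r powRr0 hornerC mulr1.
have d_sr_ge1 : 1 <= d_sr sigma rho.
  rewrite /d_sr le_max; apply/orP.
  have [tS|ntS] := pselect (trivial_set sigma); last by left; apply: d_of_nontrivial.
  by right; apply: d_of_nontrivial => // tR; apply: nontrivial.
have [dS [bS evS]] := fin_or_cofin_ultimately fS.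
have [dR [bR evR]] := fin_or_cofin_ultimately fR.
pose d := (maxn dS dR).+1.
have {}evS : ultimately d bS sigma by apply: evS; rewrite ltnW // ltnS leq_maxl.
have {}evR : ultimately d bR rho by apply: evR; rewrite ltnW // ltnS leq_maxr.
have [L0 small] := exp_small hp.
exists (solve_prog (table d sigma) bS (table d rho) bR opt).
(* The constant is kept opaque: otherwise numerals are unfolded in the final
   computation. *)
move EK : (8 * (d + d) + 700)%N => K.
exists (K%:R *: ('X + 1) ^+ 5).
pose L1 := maxn L0 (maxn (2 * d) 12).
apply: (@almost_surely_rate _ _ hp _ d.+1%:R (2 ^ L1)) => n le_n.
have le_L1 := bitlen_large le_n.
move: (le_L1); rewrite !geq_max => /and3P[le_L0 le_dL le_12].
have n1 : (1 < n)%N.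
  apply: leq_trans le_n; rewrite -[X in (X < _)%N](expn0 2) ltn_exp2l //.
  by rewrite !leq_max orbT.
have n0 := ltnW n1.
have le_block : (d * (bitlen n * bitlen n).+1 <= n)%N.
  apply: leq_trans (trunc_logP (isT : (1 < 2)%N) n0).
  apply: leq_trans (cube_leq_exp2 le_12).
  apply: leq_trans (_ : d * (2 * (bitlen n * bitlen n)) <= _)%N.
    by rewrite leq_mul // mul2n -addnn -addn1 leq_add2l.
  by rewrite mulnA (mulnC d) expnS -mulnn leq_mul.
apply: le_trans (Gnp_typical hp (isT : (0 < bitlen n)%N) (ltn_exp2_bitlen n)
  le_block (small _ le_L0)) _.
apply: Gnp_Pr_mono => // e typical_e.
have [t [a [le_t run ans]]] := typical_solves opt n0 (isT : (0 < d)%N) le_dL evS evR typical_e.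
rewrite EK in le_t; exists t, a; split=> //.
apply: le_trans (_ : (K * (n.+1 * num_codes n) ^ 5)%:R <= _); first by rewrite ler_nat.
rewrite hornerZ horner_exp hornerD hornerX hornerC natr1.
rewrite natrM natrX natrM exprMn -mulrA ler_wpM2l // ler_wpM2l ?exprn_ge0 //.
exact: num_codes_budget.
Qed.
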